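(* A smooth Riemannian 3-manifold $(M,g)$ is Sasakian if and only if there exists a geodesic congruence on $M$ (the integral curves of a smooth unit vector field $e_0$ with $\nabla_{e_0}e_0=0$) which (i) is divergence-free, (ii) is shear-free, and (iii) has twist equal to one.
   Context: Let $\nabla$ be the Levi-Civita connection and $R(X,Y)Z=\nabla_X\nabla_YZ-\nabla_Y\nabla_XZ-\nabla_{[X,Y]}Z$. A Riemannian manifold $(M,g)$ is Sasakian if there exists a unit length Killing vector field $e_0$ on $M$ such that $R(X,e_0)Y=g(e_0,Y)X-g(X,Y)e_0$ for all vector fields $X,Y$ on $M$. For a unit vector field $e_0$ tangent to a geodesic congruence, complete $e_0$ locally to an orthonormal frame $\{e_0,e_1,e_2\}$, put $e_+=\frac{1}{\sqrt2}(e_1-i\,e_2)$, $e_-=\frac{1}{\sqrt2}(e_1+i\,e_2)$, and define the complex scalars (with $g$ extended complex-bilinearly) $$\rho=-g(\nabla_{e_-}e_0,e_+),\qquad \sigma=-g(\nabla_{e_+}e_0,e_+).$$ The congruence is divergence-free if $\operatorname{Re}\rho=0$, shear-free if $\sigma=0$, and its twist is $\operatorname{Im}\rho=\tfrac12\left(g(\nabla_{e_1}e_0,e_2)-g(\nabla_{e_2}e_0,e_1)\right)$. The sign of the twist depends on the orientation of the pair $(e_1,e_2)$; ''twist equal to one'' means that near every point the frame can be chosen so that $\operatorname{Im}\rho=1$ (equivalently $|\operatorname{Im}\rho|=1$ everywhere). *)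

(* Defs.v *)
From HB Require Import structures.
From mathcomp Require Import all_boot all_order all_algebra.
From mathcomp Require Import all_classical all_reals all_analysis.
From mathcomp Require Import complex ring.

Set Implicit Arguments.
Unset Strict Implicit.
Unset Printing Implicit Defensive.
Import Order.TTheory GRing.Theory Num.Theory.
Import numFieldNormedType.Exports.

Local Open Scope classical_set_scope.
Local Open Scope ring_scope.

Section Smooth.
Context {R : realType} {n : nat} {W : normedModType R}.

Definition dirvec (i : 'I_n) : 'rV[R]_n := delta_mx 0 i.

(* Meant for open U: only then do the iterated partial derivatives at points
   of U depend on the restriction of f to U alone. *)
Fixpoint of_class_C (k : nat) (U : set 'rV[R]_n) (f : 'rV[R]_n -> W) : Prop :=
  if k is k'.+1 then
    (forall x, U x -> differentiable f x) /\
    (forall i : 'I_n, of_class_C k' U (fun x => 'D_(dirvec i) f x))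
  else forall x, U x -> {for x, continuous f}.

Definition smooth_on (U : set 'rV[R]_n) (f : 'rV[R]_n -> W) : Prop :=
  forall k, of_class_C k U f.

End Smooth.

(* The charts [chart_map c : dom c -> 'rV_n] form a smooth atlas, not required to
   be maximal; [chart_inv c] is the inverse of [chart_map c].  Both are total functions
   whose values off [dom c], resp. off [chart_map c @` dom c], are irrelevant. *)
Record smooth_manifold (R : realType) (n : nat) := SmoothManifold {
  carrier :> topologicalType;
  chart : Type;
  dom : chart -> set carrier;
  chart_map : chart -> carrier -> 'rV[R]_n;
  chart_inv : chart -> 'rV[R]_n -> carrier;
  manifold_hausdorff : hausdorff_space carrier;
  manifold_second_countable : @second_countable carrier;
  charts_cover : forall p : carrier, exists c, dom c p;
  dom_open : forall c, open (dom c);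
  chart_map_open : forall c, open (chart_map c @` dom c);
  chart_mapK : forall c p, dom c p -> chart_inv c (chart_map c p) = p;
  chart_map_continuous : forall c p, dom c p -> {for p, continuous (chart_map c)};
  chart_inv_continuous : forall c x, (chart_map c @` dom c) x ->
    {for x, continuous (chart_inv c)};
  transition_smooth : forall c d,
    smooth_on (chart_map c @` (dom c `&` dom d)) (chart_map d \o chart_inv c)
}.

Section Manifold.
Context {R : realType} {n : nat} (M : smooth_manifold R n).

Definition transition_jacobian (c d : chart M) (p : M) : 'M[R]_n :=
  'J (chart_map d \o chart_inv c) (chart_map c p).

(* A vector field is given by its component row vectors: [X c p] is the
   coordinate vector of X at p in the chart c. *)
Definition field := chart M -> M -> 'rV[R]_n.

Definition smooth_field_on (V : set M) (X : field) : Prop :=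
  (forall c d p, V p -> dom c p -> dom d p ->
     X d p = X c p *m transition_jacobian c d p) /\
  (forall c, smooth_on (chart_map c @` (dom c `&` V)) (X c \o chart_inv c)).

Definition smooth_field : field -> Prop := smooth_field_on setT.

Record riemannian_metric := RiemannianMetric {
  gram : chart M -> M -> 'M[R]_n;
  gram_sym : forall c p, dom c p -> (gram c p)^T = gram c p;
  gram_pos : forall c p, dom c p -> forall v : 'rV[R]_n, v != 0 ->
    0 < (v *m gram c p *m v^T) 0 0;
  gram_change : forall c d p, dom c p -> dom d p ->
    gram c p = transition_jacobian c d p *m gram d p
               *m (transition_jacobian c d p)^T;
  gram_smooth : forall c, smooth_on (chart_map c @` dom c) (gram c \o chart_inv c)
}.

Definition dir_deriv {W : normedModType R} (c : chart M) (v : 'rV[R]_n)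
    (F : M -> W) (p : M) : W :=
  'D_v (F \o chart_inv c) (chart_map c p).

Definition lie_bracket (X Y : field) : field := fun c p =>
  dir_deriv c (X c p) (Y c) p - dir_deriv c (Y c p) (X c) p.

Section Metric.
Variable g : riemannian_metric.

Definition inner (X Y : field) (c : chart M) (p : M) : R :=
  (X c p *m gram g c p *m (Y c p)^T) 0 0.

(* The symbol $\Gamma^k_{ij}$ of the chart c at p. *)
Definition christoffel (c : chart M) (p : M) (k i j : 'I_n) : R :=
  2^-1 * \sum_(l < n) (invmx (gram g c p)) k l *
    (dir_deriv c (dirvec i) (fun q => gram g c q j l) p
     + dir_deriv c (dirvec j) (fun q => gram g c q i l) p
     - dir_deriv c (dirvec l) (fun q => gram g c q i j) p).

(* Row i is the covariant derivative of Y along the i-th coordinate field. *)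
Definition cov_matrix (Y : field) (c : chart M) (p : M) : 'M[R]_n :=
  \matrix_(i, k) ((dir_deriv c (dirvec i) (Y c) p) 0 k
                  + \sum_(j < n) christoffel c p k i j * Y c p 0 j).

Definition nabla (X Y : field) : field := fun c p =>
  X c p *m cov_matrix Y c p.

Definition curvature (X Y Z : field) : field := fun c p =>
  nabla X (nabla Y Z) c p - nabla Y (nabla X Z) c p
  - nabla (lie_bracket X Y) Z c p.

Definition unit_field (X : field) : Prop :=
  forall c p, dom c p -> inner X X c p = 1.

(* The Lie derivative of the metric along K vanishes. *)
Definition killing_field (K : field) : Prop :=
  forall X Y, smooth_field X -> smooth_field Y -> forall c p, dom c p ->
    dir_deriv c (K c p) (inner X Y c) p =
    inner (lie_bracket K X) Y c p + inner X (lie_bracket K Y) c p.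

Definition sasakian : Prop :=
  exists e0 : field,
    [/\ smooth_field e0, unit_field e0, killing_field e0 &
      forall X Y, smooth_field X -> smooth_field Y -> forall c p, dom c p ->
        curvature X e0 Y c p =
        inner e0 Y c p *: X c p - inner X Y c p *: e0 c p].

Definition geodesic_congruence (e0 : field) : Prop :=
  [/\ smooth_field e0, unit_field e0 &
    forall c p, dom c p -> nabla e0 e0 c p = 0].

Definition orthonormal_completion (V : set M) (e0 e1 e2 : field) : Prop :=
  [/\ smooth_field_on V e1, smooth_field_on V e2 &
    forall c p, V p -> dom c p ->
      [/\ inner e0 e0 c p = 1, inner e1 e1 c p = 1 & inner e2 e2 c p = 1] /\
      [/\ inner e0 e1 c p = 0, inner e0 e2 c p = 0 & inner e1 e2 c p = 0]].

Local Open Scope complex_scope.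

Definition cvec (v : 'rV[R]_n) : 'rV[R[i]]_n := map_mx (real_complex R) v.

Definition cmat (A : 'M[R]_n) : 'M[R[i]]_n := map_mx (real_complex R) A.

(* The complex-bilinear (not sesquilinear) extension of the metric. *)
Definition cinner (c : chart M) (p : M) (v w : 'rV[R[i]]_n) : R[i] :=
  (v *m cmat (gram g c p) *m w^T) 0 0.

Definition cnabla (c : chart M) (p : M) (v : 'rV[R[i]]_n) (Y : field)
    : 'rV[R[i]]_n :=
  v *m cmat (cov_matrix Y c p).

Definition e_plus (e1 e2 : field) (c : chart M) (p : M) : 'rV[R[i]]_n :=
  ((Num.sqrt 2)^-1)%:C *: (cvec (e1 c p) - 'i *: cvec (e2 c p)).

Definition e_minus (e1 e2 : field) (c : chart M) (p : M) : 'rV[R[i]]_n :=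
  ((Num.sqrt 2)^-1)%:C *: (cvec (e1 c p) + 'i *: cvec (e2 c p)).

Definition rho (e0 e1 e2 : field) (c : chart M) (p : M) : R[i] :=
  - cinner c p (cnabla c p (e_minus e1 e2 c p) e0) (e_plus e1 e2 c p).

Definition sigma (e0 e1 e2 : field) (c : chart M) (p : M) : R[i] :=
  - cinner c p (cnabla c p (e_plus e1 e2 c p) e0) (e_plus e1 e2 c p).

Definition divergence_free (e0 : field) : Prop :=
  forall (V : set M) (e1 e2 : field), open V ->
    orthonormal_completion V e0 e1 e2 ->
    forall c p, V p -> dom c p -> complex.Re (rho e0 e1 e2 c p) = 0.

Definition shear_free (e0 : field) : Prop :=
  forall (V : set M) (e1 e2 : field), open V ->
    orthonormal_completion V e0 e1 e2 ->
    forall c p, V p -> dom c p -> sigma e0 e1 e2 c p = 0.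

Definition twist_one (e0 : field) : Prop :=
  forall p : M, exists (V : set M) (e1 e2 : field),
    [/\ open V, V p, orthonormal_completion V e0 e1 e2 &
      forall c q, V q -> dom c q -> complex.Im (rho e0 e1 e2 c q) = 1].

End Metric.
End Manifold.

(* [nabla_torsion_free] and [nabla_metric] below characterize [nabla] as the
   Levi-Civita connection of g. *)
Section LeviCivita.
Context {R : realType} {n : nat} {M : smooth_manifold R n}.
Variable g : riemannian_metric M.
Implicit Types (X Y Z : field M) (c : chart M) (p : M) (v : 'rV[R]_n).

Lemma field_differentiable X c p : smooth_field X -> dom c p ->
  differentiable (X c \o chart_inv c) (chart_map c p).
Proof.
move=> [_ /(_ c 1%N)[+ _]] dp; apply.
by exists p => //; split.
Qed.

Lemma gram_differentiable c p : dom c p ->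
  differentiable (gram g c \o chart_inv c) (chart_map c p).
Proof. by move=> dp; have [+ _] := gram_smooth g c 1%N; apply; exists p. Qed.

Lemma dir_derivE (W : normedModType R) c v (F : M -> W) p :
  differentiable (F \o chart_inv c) (chart_map c p) ->
  dir_deriv c v F p = \sum_i v 0 i *: dir_deriv c (dirvec i) F p.
Proof.
move=> dF; rewrite /dir_deriv deriveE // {1}(row_sum_delta v) linear_sum.
by apply: eq_bigr => i _; rewrite linearZ deriveE.
Qed.

Lemma dir_deriv_entry (m k : nat) c v (F : M -> 'M[R]_(m, k)) p i j :
  differentiable (F \o chart_inv c) (chart_map c p) ->
  dir_deriv c v F p i j = dir_deriv c v (fun q => F q i j) p.
Proof.
by move=> dF; rewrite /dir_deriv derive_mx ?mxE //; apply: diff_derivable.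
Qed.

Lemma dir_deriv_near (W : normedModType R) c v (F G : M -> W) p : dom c p ->
  (forall q, dom c q -> F q = G q) -> dir_deriv c v F p = dir_deriv c v G p.
Proof.
move=> dp FG; apply: near_eq_derive.
have : nbhs (chart_map c p) (chart_map c @` dom c).
  by apply: open_nbhs_nbhs; split; [exact: chart_map_open|exists p].
by apply: filterS => _ [q dq <-] /=; rewrite chart_mapK ?FG.
Qed.

Lemma gram_unit c p : dom c p -> gram g c p \in unitmx.
Proof.
move=> dp; rewrite -row_free_unit -kermx_eq0; apply/negPn/negP => /rowV0Pn[v].
move=> /sub_kermxP v0 vn0; have := gram_pos g dp vn0.
by rewrite v0 mul0mx mxE ltxx.
Qed.

Lemma dir_deriv_gram_sym c v p i j : dom c p ->
  dir_deriv c v (fun q => gram g c q i j) p = dir_deriv c v (fun q => gram g c q j i) p.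
Proof.
by move=> dp; apply: dir_deriv_near => // q dq; rewrite -{1}(gram_sym g dq) mxE.
Qed.

Lemma christoffel_sym c p k i j : dom c p ->
  christoffel g c p k i j = christoffel g c p k j i.
Proof.
move=> dp; congr (_ * _); apply: eq_bigr => l _; congr (_ * _).
by rewrite (dir_deriv_gram_sym _ i j)//; congr (_ - _); rewrite addrC.
Qed.

Lemma christoffel_lower c p l i j : dom c p ->
  \sum_k gram g c p l k * christoffel g c p k i j =
  2^-1 * (dir_deriv c (dirvec i) (fun q => gram g c q j l) p
     + dir_deriv c (dirvec j) (fun q => gram g c q i l) p
     - dir_deriv c (dirvec l) (fun q => gram g c q i j) p).
Proof.
move=> dp; pose D : 'cV[R]_n := \col_m
  (dir_deriv c (dirvec i) (fun q => gram g c q j m) p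
     + dir_deriv c (dirvec j) (fun q => gram g c q i m) p
     - dir_deriv c (dirvec m) (fun q => gram g c q i j) p).
transitivity (2^-1 * (gram g c p *m (invmx (gram g c p) *m D)) l 0).
  rewrite [in RHS]mxE mulr_sumr; apply: eq_bigr => k _.
  rewrite /christoffel mulrCA; congr (_ * (_ * _)).
  by rewrite mxE; apply: eq_bigr => m _; rewrite mxE.
by rewrite mulKVmx ?gram_unit // mxE.
Qed.

Lemma nabla_torsion_free X Y c p :
  smooth_field X -> smooth_field Y -> dom c p ->
  nabla g X Y c p - nabla g Y X c p = lie_bracket X Y c p.
Proof.
move=> sX sY dp.
have nablaE A B : smooth_field B -> nabla g A B c p = dir_deriv c (A c p) (B c) p
    + \row_k \sum_i \sum_j christoffel g c p k i j * A c p 0 i * B c p 0 j.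
  move=> sB; rewrite dir_derivE; last exact: field_differentiable.
  apply/rowP => k; rewrite !mxE summxE -big_split; apply: eq_bigr => i _ /=.
  rewrite !mxE mulrDr mulr_sumr; congr (_ + _).
  by apply: eq_bigr => j _; ring.
rewrite !nablaE // /lie_bracket opprD addrACA [X in _ + X](_ : _ = 0) ?addr0//.
apply/rowP => k; rewrite !mxE; apply/eqP; rewrite subr_eq0; apply/eqP.
rewrite exchange_big; apply: eq_bigr => i _; apply: eq_bigr => j _ /=.
by rewrite christoffel_sym //; ring.
Qed.

Lemma nabla_metric X Y Z c p :
  smooth_field Y -> smooth_field Z -> dom c p ->
  dir_deriv c (X c p) (inner g Y Z c) p =
  inner g (nabla g X Y) Z c p + inner g Y (nabla g X Z) c p.
Proof.
move=> sY sZ dp; set v := X c p.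
have dY := field_differentiable sY dp; have dZ := field_differentiable sZ dp.
have dG := gram_differentiable dp.
have cK := chart_mapK dp.
have dentry (m k : nat) (F : M -> 'M[R]_(m, k)) i j :
    differentiable (F \o chart_inv c) (chart_map c p) ->
    differentiable ((fun q => F q i j) \o chart_inv c) (chart_map c p).
  move=> dF; apply: (differentiable_comp (f := F \o chart_inv c)
     (g := fun N : 'M[R]__ => N i j)) => //; exact: differentiable_coord.
have biE (a b : 'rV[R]_n) (G : 'M[R]_n) :
    (a *m G *m b^T) 0 0 = \sum_i \sum_j a 0 i * G i j * b 0 j.
  rewrite mxE; under eq_bigr do rewrite !mxE mulr_suml.
  by rewrite exchange_big.
have innerE : inner g Y Z c \o chart_inv c = \sum_i \sum_j
    (((fun q => Y c q 0 i) \o chart_inv c)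
     * ((fun q => gram g c q i j) \o chart_inv c)
     * ((fun q => Z c q 0 j) \o chart_inv c)).
  apply/funext => x; rewrite /inner /= fct_sumE biE; apply: eq_bigr => i _.
  by rewrite fct_sumE.
have tri (w : 'rV[R]_n) : dir_deriv c w (inner g Y Z c) p =
    (dir_deriv c w (Y c) p *m gram g c p *m (Z c p)^T) 0 0
     + (Y c p *m dir_deriv c w (gram g c) p *m (Z c p)^T) 0 0
     + (Y c p *m gram g c p *m (dir_deriv c w (Z c) p)^T) 0 0.
  rewrite {1}/dir_deriv innerE !biE -!big_split derive_sum; last first.
    move=> i; apply: derivable_sum => j; apply: derivableM.
      by apply: derivableM; apply: diff_derivable; apply: dentry.
    by apply: diff_derivable; apply: dentry.
  apply: eq_bigr => i _; rewrite -!big_split derive_sum; last first.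
    move=> j; apply: derivableM.
      by apply: derivableM; apply: diff_derivable; apply: dentry.
    by apply: diff_derivable; apply: dentry.
  apply: eq_bigr => j _; rewrite !dir_deriv_entry //.
  rewrite deriveM; [|apply: derivableM|]; try
    by apply: diff_derivable; apply: dentry.
  rewrite deriveM; try by apply: diff_derivable; apply: dentry.
  rewrite mulrfctE /= cK // /dir_deriv -![_ *: _]/(_ * _); ring.
pose Gam i : 'M[R]_n := \matrix_(j, k) christoffel g c p k i j.
have GamE i : Gam i *m gram g c p + gram g c p *m (Gam i)^T
              = dir_deriv c (dirvec i) (gram g c) p.
  apply/matrixP => a b; rewrite dir_deriv_entry // !mxE.
  under eq_bigr => k _ do rewrite mxE mulrC -(gram_sym g dp) mxE.
  under [X in _ + X]eq_bigr => k _ do rewrite !mxE.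
  rewrite !christoffel_lower // (dir_deriv_gram_sym _ b a) //.
  by field.
have covE (Y' : field M) i : smooth_field Y' ->
   row i (cov_matrix g Y' c p) = dir_deriv c (dirvec i) (Y' c) p + Y' c p *m Gam i.
  move=> sY'; apply/rowP => k; rewrite !mxE; congr (_ + _).
  by apply: eq_bigr => j _; rewrite mxE mulrC.
have nabE (Y' : field M) : smooth_field Y' -> nabla g X Y' c p =
    \sum_i v 0 i *: (dir_deriv c (dirvec i) (Y' c) p + Y' c p *m Gam i).
  by move=> sY'; rewrite /nabla mulmx_sum_row; apply: eq_bigr => i _; rewrite covE.
rewrite dir_derivE; last first.
  rewrite innerE.
  apply: differentiable_sum => i; apply: differentiable_sum => j.
  by apply: differentiableM; [apply: differentiableM|]; apply: dentry.
rewrite /inner !nabE // linear_sum /= mulmx_sumr !mulmx_suml !summxE -big_split /=.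
have addE (A B : 'M[R]_1) : (A + B) 0 0 = A 0 0 + B 0 0 by rewrite mxE.
have scaleE a (A : 'M[R]_1) : (a *: A) 0 0 = a * A 0 0 by rewrite mxE.
apply: eq_bigr => i _; rewrite tri linearZ /= -!scalemxAl -!scalemxAr !scaleE.
rewrite -[_ *: _]/(_ * _) -mulrDr -GamE [(_ + _)^T]raddfD /= trmx_mul.
by rewrite !(mulmxDl, mulmxDr) !mulmxA !addE; ring.
Qed.
End LeviCivita.

(* Main.v *)
Require Import Defs.
From HB Require Import structures.
From mathcomp Require Import all_boot all_order all_algebra.
From mathcomp Require Import all_classical all_reals all_analysis.
From mathcomp Require Import complex ring lra.

(** Write phi X for the covariant derivative of e0 along X. A unit field e0 is
    Killing iff phi is skew. If phi is skew, then [R(X,e0)e0] pairs with X to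
    |phi X|^2; in a Sasakian manifold this equals |X|^2 - g(X,e0)^2, so that
    e1 = phi X / |phi X| and e2 = phi e1 complete e0 to a frame of twist one.
    Conversely, the conditions on the congruence say that phi is the rotation by
    a right angle of the plane orthogonal to e0; differentiating
    g(phi X, phi X) = |X|^2 - g(X,e0)^2 and phi e0 = 0 determines the covariant
    derivative of phi, hence [R(X,Y)e0]. Then g(R(X,e0)Y,Z) is skew in (Y,Z), and
    by the Bianchi identity its antisymmetrization in (X,Y) is known, which
    determines it.

    Since the definitions test the Killing and curvature identities on
    global fields only, pointwise values are reached by cutting off fields with
    the flat function exp(-1/t). *)

Set Implicit Arguments.
Unset Strict Implicit.
Unset Printing Implicit Defensive.
Import Order.TTheory GRing.Theory Num.Theory.
Import numFieldNormedType.Exports.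

Local Open Scope classical_set_scope.
Local Open Scope ring_scope.

(** * Functions of class C^k *)

(** A field is a family of component vectors, one per chart, and neither the curvature nor the
    covariant derivative of phi is shown to depend on pointwise values alone. A vector is therefore
    always replaced by a global field through it, even for the frame: e1 is extended to a field E1,
    and phi e1 to the field phi E1. For this, the covariant derivative of smooth fields must again
    be a smooth field, transformation law included. That law is read off the Koszul formula, whose
    terms are chart independent once brackets are; the law for brackets, like the Jacobi and Bianchi
    identities, rests on the symmetry of second derivatives. Dimension three enters the converse as
    follows. The difference D between the covariant derivative of phi and its claimed value is skew,
    kills e0, and D Z is orthogonal to Z and to phi Z; at Z = e1 this leaves no direction for D Z.
    In the direct implication, a vector orthogonal to e0 at one point is easy to extend, but not so
    as to stay orthogonal nearby. Taking e1 in the image of phi, which is orthogonal to e0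
    everywhere, removes the difficulty. *)

(** [g] is [f] minus a function that vanishes near [x]; the latter is differentiable at [x] with
    differential 0. *)
Lemma near_eq_differentiable (R : numFieldType) (V W : normedModType R)
    (f g : V -> W) (x : V) :
  (\near x, f x = g x) -> differentiable f x -> differentiable g x.
Proof.
move=> fg df; rewrite -[g](subKr f); apply: differentiableB => //.
have [e fge] : exists e : V -> W, e = f - g by exists (f - g).
have e0 : \forall h \near (0 : V), e (h + x) = 0.
  move: fg; rewrite (near_shift 0 x); apply: filterS => h /=.
  by rewrite subr0 fge !fctE => ->; rewrite subrr.
have ex0 : e x = 0 by have := nbhs_singleton e0; rewrite add0r.
rewrite -fge; have ee : e \o shift x = cst (e x) + (\0 : {linear V -> W}) +o_ (0 : V) id.
  apply/eqaddoP => _/posnumP[eps]; near=> h.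
  rewrite /= !fctE /= ex0 !addr0 subr0.
  have -> : e (h + x) = 0 by near: h.
  by rewrite normr0 mulr_ge0.
have e'0 : 'd e x = (\0 : {linear V -> W}) :> (V -> W).
  by apply: diff_unique => //; exact: cst_continuous.
by apply/diff_locallyP; rewrite e'0; split => //; exact: cst_continuous.
Unshelve. all: by end_near. Qed.

Lemma derive_comp_real (R : realType) (V : normedModType R) (h : R -> R) (f : V -> R)
    (x v : V) : differentiable f x -> differentiable h (f x) ->
  'D_v (h \o f) x = 'D_v f x * 'D_1 h (f x).
Proof.
move=> df dh; have dhf : differentiable (h \o f) x by exact: differentiable_comp.
rewrite (deriveE _ dhf) (diff_comp df dh) /= deriv1E; last exact/derivable1_diffP.
by rewrite derive1E (deriveE _ df).
Qed.

Section CkFunctions.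
Context {R : realType} {n : nat}.
Implicit Types (U V : set 'rV[R]_n).

Section Vector.
Context {W : normedModType R}.
Implicit Types f g : 'rV[R]_n -> W.

Lemma of_class_C_continuous k U f : of_class_C k U f ->
  forall x, U x -> {for x, continuous f}.
Proof.
case: k => [//|k] [+ _] x Ux => /(_ x Ux); exact: differentiable_continuous.
Qed.

Lemma of_class_CW k U f : of_class_C k.+1 U f -> of_class_C k U f.
Proof.
elim: k f => [|k IH] f [df Df].
  by move=> x Ux; apply: differentiable_continuous; exact: df.
by split=> // i; apply: IH.
Qed.

Lemma of_class_C_sub k U V f : V `<=` U -> of_class_C k U f -> of_class_C k V f.
Proof.
move=> VU; elim: k f => [|k IH] f /=; first by move=> cf x /VU/cf.
by move=> [df Df]; split=> [x /VU/df //|i]; apply: IH.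
Qed.

(** Derivatives see a neighbourhood of each point, so [U] has to be open. The closure proofs below
    use this to trade a partial derivative for the formula that computes it. *)
Lemma of_class_C_eq k U f g : open U -> (forall x, U x -> f x = g x) ->
  of_class_C k U f -> of_class_C k U g.
Proof.
move=> oU; elim: k f g => [|k IH] f g fg /=.
  move=> cf x Ux; have fgx : \near x, f x = g x.
    by apply: filterS fg _; exact: open_nbhs_nbhs.
  have : f y @[y --> x] --> f x := cf x Ux.
  rewrite (fg _ Ux).
  rewrite -[{for x, continuous g}]/(g y @[y --> x] --> g x).
  by move=> cfg; apply: cvg_trans cfg; apply: near_eq_cvg fgx.
move=> [df Df]; have near_fg x : U x -> \near x, f x = g x.
  by move=> Ux; apply: filterS fg _; exact: open_nbhs_nbhs.
split=> [x Ux|i].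
  by apply: near_eq_differentiable (near_fg x Ux) _; exact: df.
by apply: IH (Df i) => x Ux; apply: near_eq_derive; exact: near_fg.
Qed.

Lemma of_class_C_local k U f :
  (forall x, U x -> exists2 V, V x & of_class_C k V f) -> of_class_C k U f.
Proof.
elim: k f => [|k IH] f /= loc.
  by move=> x /loc[V Vx cf]; exact: cf.
split=> [x /loc[V Vx [df _]]|i]; first exact: df.
by apply: IH => x /loc[V Vx [_ Df]]; exists V.
Qed.

Lemma of_class_C_cst k U (a : W) : of_class_C k U (fun=> a).
Proof.
elim: k a => [|k IH] a /=; first by move=> x _; exact: cst_continuous.
split=> [x _|i]; first exact: differentiable_cst.
have -> : (fun x => 'D_(dirvec i) (fun=> a) x) = (fun=> 0 : W); last exact: IH.
by apply/funext => x; exact: derive_cst.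
Qed.

End Vector.

Lemma of_class_C_comp_coord k U (a b : nat) (F : 'rV[R]_n -> 'M[R]_(a, b)) i j :
  open U -> of_class_C k U F -> of_class_C k U (fun x => F x i j).
Proof.
move=> oU; elim: k F => [|k IH] F /=.
  move=> cF x Ux; apply: (@continuous_comp _ _ _ F (fun N : 'M[R]_(a, b) => N i j)).
    exact: cF.
  exact: coord_continuous.
move=> [dF DF]; split=> [x Ux|l].
  apply: (@differentiable_comp _ _ _ _ F (fun N : 'M[R]_(a, b) => N i j)).
    exact: dF.
  exact: differentiable_coord.
apply: of_class_C_eq (IH _ (DF l)) => // x Ux /=.
by rewrite derive_mx ?mxE //; apply: diff_derivable; exact: dF.
Qed.

Lemma matrix_fun_sum_delta (a b : nat) (T : Type) (F : T -> 'M[R]_(a, b)) :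
  F = \sum_i \sum_j (fun x => F x i j *: delta_mx i j).
Proof.
apply/funext => x; rewrite fct_sumE {1}[F x]matrix_sum_delta.
by apply: eq_bigr => i _; rewrite fct_sumE.
Qed.

Lemma differentiable_mxP (V : normedModType R) (a b : nat) (F : V -> 'M[R]_(a, b)) x :
  (forall i j, differentiable (fun x => F x i j) x) -> differentiable F x.
Proof.
move=> dF; rewrite [F]matrix_fun_sum_delta; apply: differentiable_sum => i.
by apply: differentiable_sum => j; apply: differentiableZl.
Qed.

(** Reduces matrix-valued functions to scalar ones, so that the differentiation rules are proved for
    scalars only. *)
Lemma of_class_C_mxP k U (a b : nat) (F : 'rV[R]_n -> 'M[R]_(a, b)) : open U ->
  of_class_C k U F <-> forall i j, of_class_C k U (fun x => F x i j).
Proof.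
move=> oU; split=> [CF i j|]; first exact: of_class_C_comp_coord.
elim: k F => [|k IH] F CF /=.
  move=> x Ux; suff : F y @[y --> x] --> F x by [].
  apply: (cvgrPdist_le (FF := nbhs_filter x) F (F x)).2 => e e0; near=> y.
  rewrite /Num.Def.normr/= mx_normrE (bigmax_le _ (ltW e0))//= => i _.
  rewrite !mxE /=; move: i; near: y; apply: filter_forall => /= i.
  have : F y i.1 i.2 @[y --> x] --> F x i.1 i.2 := CF i.1 i.2 x Ux.
  by move=> /(cvgrPdist_le (FF := nbhs_filter x)); apply.
have dF x : U x -> differentiable F x.
  by move=> Ux; apply: differentiable_mxP => i j; exact: (CF i j).1.
split=> // l; apply: IH => i j; have [_ /(_ l)] := CF i j.
apply: of_class_C_eq => // x Ux.
by rewrite derive_mx ?mxE //; apply: diff_derivable; exact: dF.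
Unshelve. all: by end_near. Qed.


Section Scalar.
Implicit Types f g : 'rV[R]_n -> R.

Lemma of_class_CD k U f g : open U -> of_class_C k U f -> of_class_C k U g ->
  of_class_C k U (fun x => f x + g x).
Proof.
move=> oU; elim: k f g => [|k IH] f g /=.
  by move=> cf cg x Ux; apply: continuousD; [exact: cf|exact: cg].
move=> [df Df] [dg Dg]; split=> [x Ux|i].
  by apply: differentiableD; [exact: df|exact: dg].
apply: of_class_C_eq (IH _ _ (Df i) (Dg i)) => // x Ux /=.
by rewrite -deriveD //; apply: diff_derivable; [exact: df|exact: dg].
Qed.

(** The product rule brings back [f] and [g] undifferentiated; [of_class_CW] lowers them to the
    class that the induction hypothesis takes. *)
Lemma of_class_CM k U f g : open U -> of_class_C k U f -> of_class_C k U g ->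
  of_class_C k U (fun x => f x * g x).
Proof.
move=> oU; elim: k f g => [|k IH] f g.
  by move=> cf cg x Ux; apply: continuousM; [exact: cf|exact: cg].
move=> /[dup] /of_class_CW Cf [df Df] /[dup] /of_class_CW Cg [dg Dg].
split=> [x Ux|i]; first by apply: differentiableM; [exact: df|exact: dg].
apply: of_class_C_eq (of_class_CD oU (IH _ _ Cf (Dg i)) (IH _ _ Cg (Df i))) => //.
move=> x Ux /=.
by rewrite deriveM //; apply: diff_derivable; [exact: df|exact: dg].
Qed.

Lemma of_class_CN k U f : open U -> of_class_C k U f ->
  of_class_C k U (fun x => - f x).
Proof.
move=> oU Cf; apply: of_class_C_eq (of_class_CM oU (of_class_C_cst k U (-1 : R)) Cf) => //.
by move=> x _; rewrite mulN1r.
Qed.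

Lemma of_class_CB k U f g : open U -> of_class_C k U f -> of_class_C k U g ->
  of_class_C k U (fun x => f x - g x).
Proof. by move=> oU Cf Cg; apply: of_class_CD => //; exact: of_class_CN. Qed.

Lemma of_class_C_sum k U (I : Type) (r : seq I) (P : pred I) (F : I -> 'rV[R]_n -> R) :
  open U -> (forall i, P i -> of_class_C k U (F i)) ->
  of_class_C k U (fun x => \sum_(i <- r | P i) F i x).
Proof.
move=> oU CF; elim: r => [|i r IH].
  apply: of_class_C_eq (of_class_C_cst k U (0 : R)) => // x _; by rewrite big_nil.
have [Pi|Pi] := boolP (P i).
  apply: of_class_C_eq (of_class_CD oU (CF i Pi) IH) => // x _.
  by rewrite big_cons Pi.
by apply: of_class_C_eq IH => // x _; rewrite big_cons (negbTE Pi).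
Qed.

Lemma of_class_C_prod k U (I : Type) (r : seq I) (P : pred I) (F : I -> 'rV[R]_n -> R) :
  open U -> (forall i, P i -> of_class_C k U (F i)) ->
  of_class_C k U (fun x => \prod_(i <- r | P i) F i x).
Proof.
move=> oU CF; elim: r => [|i r IH].
  apply: of_class_C_eq (of_class_C_cst k U (1 : R)) => // x _; by rewrite big_nil.
have [Pi|Pi] := boolP (P i).
  apply: of_class_C_eq (of_class_CM oU (CF i Pi) IH) => // x _.
  by rewrite big_cons Pi.
by apply: of_class_C_eq IH => // x _; rewrite big_cons (negbTE Pi).
Qed.

(** The derivative of 1/f is again expressed by 1/f, whose regularity one class lower is the
    induction hypothesis. The square root below works in the same way. *)
Lemma of_class_CV k U f : open U -> (forall x, U x -> f x != 0) ->
  of_class_C k U f -> of_class_C k U (fun x => (f x)^-1).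
Proof.
move=> oU f0; elim: k => [|k IH].
  by move=> cf x Ux; apply: continuousV; [exact: f0|exact: cf].
move=> /[dup] /of_class_CW /IH CV [df Df].
split=> [x Ux|i]; first by apply: differentiableV; [exact: df|exact: f0].
apply: of_class_C_eq (of_class_CN oU (of_class_CM oU (of_class_CM oU CV CV) (Df i))) => //.
move=> x Ux; rewrite deriveV; [|exact: f0|by apply: diff_derivable; exact: df].
by rewrite -[_ *: _]/(_ * _) mulNr -exprVn expr2.
Qed.

Lemma of_class_C_sqrt k U f : open U -> (forall x, U x -> 0 < f x) ->
  of_class_C k U f -> of_class_C k U (fun x => Num.sqrt (f x)).
Proof.
move=> oU f0; have ds x : U x -> differentiable (@Num.sqrt R) (f x).
  by move=> Ux; apply/derivable1_diffP; have [] := is_derive1_sqrt (f0 x Ux).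
elim: k => [|k IH].
  move=> cf x Ux; apply: continuous_comp; [exact: cf|exact: sqrt_continuous].
move=> /[dup] /of_class_CW /IH Cs [df Df].
split=> [x Ux|i]; first exact: differentiable_comp (df x Ux) (ds x Ux).
have C2 := of_class_CM oU (of_class_C_cst k U (2 : R)) Cs.
have s2 x : U x -> 2 * Num.sqrt (f x) != 0.
  by move=> /f0 fx0; rewrite mulf_neq0 // gt_eqF ?sqrtr_gt0.
apply: of_class_C_eq (of_class_CM oU (Df i) (of_class_CV oU s2 C2)) => // x Ux.
apply: etrans (esym (derive_comp_real (dirvec i) (df x Ux) (ds x Ux))).
by rewrite derive_sqrt //; exact: f0.
Qed.

Lemma of_class_C_coord k U (i : 'I_n) : of_class_C k U (fun x => x 0 i).
Proof.
case: k => [|k]; first by move=> x _; exact: coord_continuous.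
split=> [x _|j]; first exact: differentiable_coord.
have -> : (fun x => 'D_(dirvec j) (fun x : 'rV[R]_n => x 0 i) x) =
    (fun=> dirvec j 0 i); last exact: of_class_C_cst.
apply/funext => x.
have Did : 'D_(dirvec j) (@id 'rV[R]_n) x = \matrix_(k, l)
    'D_(dirvec j) (fun t : 'rV[R]_n => t k l) x.
  by apply: (@derive_mx R 'rV[R]_n _ _ id); exact: derivable_id.
by have := congr1 (fun v : 'rV[R]_n => v 0 i) Did; rewrite derive_id [RHS]mxE => ->.
Qed.

End Scalar.


Section Matrix.
Context {a b : nat}.
Implicit Types F G : 'rV[R]_n -> 'M[R]_(a, b).

Lemma of_class_C_mxD k U F G : open U -> of_class_C k U F -> of_class_C k U G ->
  of_class_C k U (fun x => F x + G x).
Proof.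
move=> oU /(of_class_C_mxP _ _ oU) CF /(of_class_C_mxP _ _ oU) CG.
apply/(of_class_C_mxP _ _ oU) => i j.
by apply: of_class_C_eq (of_class_CD oU (CF i j) (CG i j)) => // x _; rewrite mxE.
Qed.

Lemma of_class_C_mxN k U F : open U -> of_class_C k U F ->
  of_class_C k U (fun x => - F x).
Proof.
move=> oU /(of_class_C_mxP _ _ oU) CF; apply/(of_class_C_mxP _ _ oU) => i j.
by apply: of_class_C_eq (of_class_CN oU (CF i j)) => // x _; rewrite mxE.
Qed.

Lemma of_class_C_mxB k U F G : open U -> of_class_C k U F -> of_class_C k U G ->
  of_class_C k U (fun x => F x - G x).
Proof. by move=> oU CF CG; apply: of_class_C_mxD => //; exact: of_class_C_mxN. Qed.

Lemma of_class_C_mxZ k U (f : 'rV[R]_n -> R) F : open U ->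
  of_class_C k U f -> of_class_C k U F -> of_class_C k U (fun x => f x *: F x).
Proof.
move=> oU Cf /(of_class_C_mxP _ _ oU) CF; apply/(of_class_C_mxP _ _ oU) => i j.
by apply: of_class_C_eq (of_class_CM oU Cf (CF i j)) => // x _; rewrite mxE.
Qed.

Lemma of_class_C_trmx k U F : open U -> of_class_C k U F ->
  of_class_C k U (fun x => (F x)^T).
Proof.
move=> oU /(of_class_C_mxP _ _ oU) CF; apply/(of_class_C_mxP _ _ oU) => i j.
by apply: of_class_C_eq (CF j i) => // x _; rewrite mxE.
Qed.

Lemma of_class_C_mulmx k U (c : nat) F (G : 'rV[R]_n -> 'M[R]_(b, c)) : open U ->
  of_class_C k U F -> of_class_C k U G -> of_class_C k U (fun x => F x *m G x).
Proof.
move=> oU /(of_class_C_mxP _ _ oU) CF /(of_class_C_mxP _ _ oU) CG.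
apply/(of_class_C_mxP _ _ oU) => i j.
pose S x := \sum_l F x i l * G x l j.
apply: (@of_class_C_eq _ _ _ S) => [//|x _|]; first by rewrite mxE.
by apply: of_class_C_sum => // l _; apply: of_class_CM.
Qed.

End Matrix.

Lemma of_class_C_det k U (a : nat) (F : 'rV[R]_n -> 'M[R]_a) : open U ->
  of_class_C k U F -> of_class_C k U (fun x => \det (F x)).
Proof.
move=> oU /(of_class_C_mxP _ _ oU) CF; apply: of_class_C_sum => // s _.
apply: of_class_CM => //; first exact: of_class_C_cst.
exact: of_class_C_prod.
Qed.

(** By Cramer's rule the inverse is the adjugate over the determinant, both polynomial in the
    entries. *)
Lemma of_class_C_invmx k U (a : nat) (F : 'rV[R]_n -> 'M[R]_a) : open U ->
  (forall x, U x -> F x \in unitmx) ->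
  of_class_C k U F -> of_class_C k U (fun x => invmx (F x)).
Proof.
move=> oU Fu CF; pose G x := (\det (F x))^-1 *: \adj (F x).
apply: (@of_class_C_eq _ _ _ G) => [//|x Ux|]; first by rewrite /invmx Fu.
apply: of_class_C_mxZ => //.
  apply: of_class_CV => // [x /Fu|]; first by rewrite unitmxE unitfE.
  exact: of_class_C_det.
apply/of_class_C_mxP => // i j.
pose H x := cofactor (F x) j i.
apply: (@of_class_C_eq _ _ _ H) => [//|x _|]; first by rewrite mxE.
apply: of_class_CM => //; first exact: of_class_C_cst.
apply: of_class_C_det => //; apply/of_class_C_mxP => // i' j'.
pose K x := F x (lift j i') (lift i j').
apply: (@of_class_C_eq _ _ _ K) => [//|x _|]; first by rewrite !mxE.
by have /of_class_C_mxP := CF; apply.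
Qed.

End CkFunctions.

Lemma derive_sum_dirvec (R : realType) (n : nat) (W : normedModType R)
    (f : 'rV[R]_n -> W) x v :
  differentiable f x -> 'D_v f x = \sum_i v 0 i *: 'D_(dirvec i) f x.
Proof.
move=> df; rewrite deriveE // {1}(row_sum_delta v) linear_sum.
by apply: eq_bigr => i _; rewrite linearZ deriveE.
Qed.

(** * Chain rule and composition *)

Section Composition.
Context {R : realType} {n m : nat}.

Lemma derive_comp_rV (W : normedModType R) (f : 'rV[R]_m -> W) (t : 'rV[R]_n -> 'rV[R]_m)
    x v : differentiable t x -> differentiable f (t x) ->
  'D_v (f \o t) x = 'D_('D_v t x) f (t x).
Proof.
move=> dt df; rewrite !deriveE //; last exact: differentiable_comp.
by rewrite diff_comp.
Qed.

Lemma of_class_C_comp k (U : set 'rV[R]_m) (V : set 'rV[R]_n) (f : 'rV[R]_m -> R)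
    (t : 'rV[R]_n -> 'rV[R]_m) : open V -> (forall x, V x -> U (t x)) ->
  of_class_C k U f -> of_class_C k V t -> of_class_C k V (f \o t).
Proof.
move=> oV VU; elim: k f => [|k IH] f.
  move=> cf ct x Vx; apply: (@continuous_comp _ _ _ t f); first exact: ct.
  exact/cf/VU.
move=> [df Df] /[dup] /of_class_CW Ct [dt Dt].
split=> [x Vx|i].
  by apply: (@differentiable_comp _ _ _ _ t f); [exact: dt|exact/df/VU].
pose S x := \sum_j ('D_(dirvec i) t x) 0 j * ('D_(dirvec j) f \o t) x.
apply: (@of_class_C_eq _ _ _ _ _ S) => [//|x Vx|].
  rewrite derive_comp_rV; [|exact: dt|exact/df/VU].
  by rewrite [RHS]derive_sum_dirvec //; exact/df/VU.
apply: of_class_C_sum => // j _; apply: of_class_CM => //.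
  by apply: of_class_C_comp_coord => //; exact: Dt.
by apply: IH => //; exact: Df.
Qed.

End Composition.

(** * Symmetry of second derivatives *)

Section Schwarz.
Context {R : realType} {n : nat}.
Implicit Types (U : set 'rV[R]_n) (f : 'rV[R]_n -> R) (x u v : 'rV[R]_n).

Lemma is_derive_line f x u (a : R) : differentiable f (x + a *: u) ->
  is_derive a 1 (fun a => f (x + a *: u)) ('D_u f (x + a *: u)).
Proof.
move=> df; pose l (a : R) := x + a *: u.
have dl : is_diff a l (0 + *:%R ^~ u).
  exact: is_diffD (is_diff_cst x a) (is_diff_scalel a u).
have dl' : differentiable l a by case: dl.
have dfl : differentiable (f \o l) a by apply: differentiable_comp.
apply: DeriveDef; first exact: diff_derivable.
rewrite deriveE // diff_comp //.
by rewrite /= (@diff_val _ _ _ _ _ _ _ dl) !fctE add0r scale1r deriveE.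
Qed.

(** The mean value theorem twice: along [u], for the increment of [f] over the step [s *: v], then
    along [v], for ['D_u f]. *)
Lemma second_difference f x u v (s : R) : 0 < s ->
  (forall a b, 0 <= a <= s -> 0 <= b <= s -> differentiable f (x + a *: u + b *: v)) ->
  (forall a b, 0 <= a <= s -> 0 <= b <= s ->
    differentiable ('D_u f) (x + a *: u + b *: v)) ->
  exists a b, [/\ 0 <= a <= s, 0 <= b <= s &
    f (x + s *: u + s *: v) - f (x + s *: u) - (f (x + s *: v) - f x)
    = 'D_v ('D_u f) (x + a *: u + b *: v) * s * s].
Proof.
move=> s0 df Df; have ss : 0 <= s <= s by rewrite lexx ltW.
have s00 : 0 <= (0 : R) <= s by rewrite lexx ltW.
pose phi (a : R) := f (x + s *: v + a *: u) - f (x + a *: u).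
pose dphi (a : R) := 'D_u f (x + s *: v + a *: u) - 'D_u f (x + a *: u).
have phi_d (a : R) : 0 <= a <= s -> is_derive a 1 phi (dphi a).
  move=> a0s; apply: is_deriveB; apply: is_derive_line.
    by have := df a s a0s ss; rewrite addrAC.
  by have := df a 0 a0s s00; rewrite scale0r addr0.
have [a a0s phiE] : exists2 a, a \in `]0, s[ & phi s - phi 0 = dphi a * (s - 0).
  apply: MVT => [//|a|].
    by rewrite in_itv /= => /andP[? ?]; apply: phi_d; rewrite !ltW.
  by apply: derivable_within_continuous => a; rewrite in_itv => /phi_d[].
have {}a0s : 0 <= a <= s by move: a0s; rewrite in_itv /= => /andP[? ?]; rewrite !ltW.
pose psi (b : R) := 'D_u f (x + a *: u + b *: v).
pose dpsi (b : R) := 'D_v ('D_u f) (x + a *: u + b *: v).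
have psi_d (b : R) : 0 <= b <= s -> is_derive b 1 psi (dpsi b).
  by move=> b0s; apply: is_derive_line; exact: Df.
have [b b0s psiE] : exists2 b, b \in `]0, s[ & psi s - psi 0 = dpsi b * (s - 0).
  apply: MVT => [//|b|].
    by rewrite in_itv /= => /andP[? ?]; apply: psi_d; rewrite !ltW.
  by apply: derivable_within_continuous => b; rewrite in_itv => /psi_d[].
have {}b0s : 0 <= b <= s by move: b0s; rewrite in_itv /= => /andP[? ?]; rewrite !ltW.
exists a, b; split => //.
move: phiE; rewrite subr0 /phi scale0r !addr0 (addrAC x (s *: u)) => ->; congr (_ * s).
by move: psiE; rewrite subr0 /psi scale0r addr0 /dphi (addrAC x (s *: v)) => ->.
Qed.

(** The second difference is symmetric in the two directions. So [P] and [Q] take a common value at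
    two points close to [x], and both are continuous at [x]. *)
Lemma derive_comm_scalar U f x (i j : 'I_n) : open U -> U x -> of_class_C 2 U f ->
  'D_(dirvec i) ('D_(dirvec j) f) x = 'D_(dirvec j) ('D_(dirvec i) f) x.
Proof.
move=> oU Ux [df Df]; set u := dirvec j; set v := dirvec i.
pose P := 'D_v ('D_u f); pose Q := 'D_u ('D_v f).
have nearP e : 0 < e -> \forall y \near x, `|P x - P y| <= e.
  have cP : P y @[y --> x] --> P x by have [_ /(_ i)] := Df j; apply.
  exact: (cvgrPdist_le (FF := nbhs_filter x) P (P x)).1 cP e.
have nearQ e : 0 < e -> \forall y \near x, `|Q x - Q y| <= e.
  have cQ : Q y @[y --> x] --> Q x by have [_ /(_ j)] := Df i; apply.
  exact: (cvgrPdist_le (FF := nbhs_filter x) Q (Q x)).1 cQ e.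
apply/eqP; rewrite -subr_eq0 -normr_le0; apply/ler_addgt0Pl => e e0; rewrite addr0.
have e20 : 0 < e / 2 by rewrite divr_gt0.
have nearU : \forall y \near x, U y by apply: open_nbhs_nbhs.
have /nbhs_ballP[d /= d0 dU] : \forall y \near x,
    U y /\ (`|P x - P y| <= e / 2 /\ `|Q x - Q y| <= e / 2).
  by apply: filterI nearU (filterI (nearP _ e20) (nearQ _ e20)).
(* The summand 1 keeps the divisor positive; with [s] = d/(2N) every point of the parallelogram is
   within d/2 of [x]. *)
pose N := `|u| + `|v| + 1; have N0 : 0 < N by rewrite ltr_wpDl // addr_ge0.
pose s := d / N / 2; have s0 : 0 < s by rewrite !divr_gt0.
have near_x (a b : R) : 0 <= a <= s -> 0 <= b <= s -> ball x d (x + a *: u + b *: v).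
  move=> /andP[a0 as_] /andP[b0 bs]; rewrite -ball_normE /ball_ /=.
  rewrite -addrA opprD addrA subrr sub0r normrN.
  apply: (@le_lt_trans _ _ (s * (`|u| + `|v|))).
    by rewrite mulrDr (le_trans (ler_normD _ _)) // !normrZ !ger0_norm // lerD // ler_wpM2r.
  apply: (@lt_trans _ _ (s * N)); first by rewrite ltr_pM2l // ltrDl.
  by rewrite /s mulrAC divfK ?gt_eqF // ltr_pdivrMr // ltr_pMr // ltr1n.
have [a [b [a0s b0s E1]]] : exists a b, [/\ 0 <= a <= s, 0 <= b <= s &
    f (x + s *: u + s *: v) - f (x + s *: u) - (f (x + s *: v) - f x)
    = 'D_v ('D_u f) (x + a *: u + b *: v) * s * s].
  apply: second_difference => // a b a0s b0s; have [Uy _] := dU _ (near_x _ _ a0s b0s).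
    exact: df.
  by have [+ _] := Df j; apply.
have [a' [b' [a'0s b'0s E2]]] : exists a b, [/\ 0 <= a <= s, 0 <= b <= s &
    f (x + s *: v + s *: u) - f (x + s *: v) - (f (x + s *: u) - f x)
    = 'D_u ('D_v f) (x + a *: v + b *: u) * s * s].
  apply: second_difference => // a' b' a'0s b'0s;
    have [Uy _] := dU _ (near_x _ _ b'0s a'0s); rewrite addrAC; first exact: df.
  by have [+ _] := Df i; apply.
have EE : P (x + a *: u + b *: v) = Q (x + a' *: v + b' *: u).
  rewrite /P /Q.
  have ss0 : s * s != 0 by rewrite mulf_neq0 // gt_eqF.
  move: E1 E2; rewrite (addrAC x (s *: v)).
  move: ('D_v ('D_u f) _) ('D_u ('D_v f) _) => p q E1 E2.
  apply: (mulIf ss0); rewrite [LHS]mulrA [RHS]mulrA -E1 -E2.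
  by rewrite !opprB addrACA [RHS]addrACA; congr (_ + _); rewrite addrC.
have [_ [P1 _]] := dU _ (near_x _ _ a0s b0s).
have [_ [_ P2]] := dU _ (near_x _ _ b'0s a'0s).
rewrite (addrAC x) -EE in P2.
rewrite [e]splitr -(subrKA (P (x + a *: u + b *: v))).
apply: le_trans (ler_normD _ _) _; apply: lerD; first exact: P1.
by rewrite distrC; exact: P2.
Qed.

End Schwarz.

(** * A flat function *)

Section Flat.
Context {R : realType}.
Implicit Types (t : R) (m : nat).

(** The powers of 1/t make the family closed under differentiation, up to linear combinations, so
    that smoothness is one induction over all [m] at once. *)
Definition flat m t : R := if 0 < t then t^-1 ^+ m * expR (- t^-1) else 0.

(** The exponential of x = 1/t dominates the term of degree m+2 of its series. The quadratic bound
    is what the derivative at 0 needs. *)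
Lemma flat_le m t : `|flat m t| <= (m.+2)`!%:R * t ^+ 2.
Proof.
rewrite /flat; case: ifPn => [t0|_]; last first.
  by rewrite normr0 mulr_ge0 // sqr_ge0.
have x0 : 0 <= t^-1 by rewrite invr_ge0 ltW.
have c0 : 0 < (m.+2)`!%:R * t ^+ m.+2 :> R.
  by rewrite mulr_gt0 ?exprn_gt0 // ltr0n fact_gt0.
rewrite ger0_norm; last by rewrite mulr_ge0 ?expR_ge0 // exprn_ge0.
rewrite exprVn ler_pdivrMl ?exprn_gt0 // mulrCA -exprD addn2 expRN.
rewrite invf_ple ?posrE ?expR_gt0 //; apply: le_trans (expR_ge1Dxn m.+1 x0).
by rewrite exprVn invfM mulrC lerDr.
Qed.

Lemma is_derive_flat m t :
  is_derive t 1 (flat m) (flat m.+2 t - m%:R * flat m.+1 t).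
Proof.
have [t0|t0|<-] := ltgtP 0 t.
- have t0' : t != 0 by rewrite gt_eqF.
  pose P (u : R) := u ^+ m * expR (- u).
  have nE : \near t, (P \o GRing.inv) t = flat m t.
    near=> s; rewrite /flat ifT //; near: s.
    by apply: open_nbhs_nbhs; split; [exact: open_gt|].
  apply: near_eq_is_derive nE _.
  pose dP (u : R) := u ^+ m *: (expR (- u) * -1) + expR (- u) *: (m%:R * u ^+ m.-1).
  have DP (u : R) : is_derive u 1 P (dP u).
    have DE : is_derive u 1 (expR \o -%R) (expR (- u) * -1).
      exact: is_derive1_comp.
    apply: (is_deriveM _ DE).
    apply: DeriveDef; first exact: exprn_derivable.
    by rewrite exp_derive scaler1.
  have Dinv : is_derive t 1 GRing.inv (- t ^- 2 *: 1).
    exact: (@is_deriveV _ id t 1 1 t0' (is_derive_id t 1)).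
  have DPt := is_derive1_comp (DP t^-1) Dinv.
  rewrite (_ : flat _ _ - _ = dP t^-1 * (- t ^- 2 *: 1)) //.
  rewrite /dP /flat t0 -![_ *: _]/(_ * _) mulr1 -exprVn.
  move: (t^-1) (expR _) => u E; case: m {P dP DP DPt} => [|m'] /=.
    rewrite !expr0; ring.
  rewrite -natr1 !exprS; ring.
- have nE : \near t, 0 = flat m t.
    near=> s; rewrite /flat ifF //; apply/negbTE; rewrite -leNgt ltW //; near: s.
    by apply: open_nbhs_nbhs; split; [exact: open_lt|].
  rewrite /flat !ltNge ltW //= mulr0 subr0.
  by apply: near_eq_is_derive nE _.
- rewrite /flat ltxx mulr0 subr0 -/(flat m).
  (* By [flat_le] the difference quotient is at most (m+2)! |h|. *)
  have cvg0 : h^-1 *: (flat m (h *: 1 + 0) - flat m 0) @[h --> 0^'] --> (0 : R).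
    apply/cvgrPdist_le => /= e e0; near=> h.
    have h0 : h != 0 by near: h; exact: nbhs_dnbhs_neq.
    rewrite sub0r normrN addr0 {2}/flat ltxx subr0 [h *: 1]mulr1.
    rewrite normrM normfV ler_pdivrMl ?normr_gt0 //.
    apply: le_trans (flat_le _ _) _.
    have F0 : 0 < (m.+2)`!%:R :> R by rewrite ltr0n fact_gt0.
    rewrite -real_normK ?num_real // expr2 mulrCA ler_pM2l ?normr_gt0 //.
    rewrite mulrC -ler_pdivlMr //; near: h; apply: dnbhs0_le.
    by rewrite divr_gt0.
  apply: DeriveDef; first exact: cvgP cvg0.
  exact: cvg_lim cvg0.
Unshelve. all: by end_near. Qed.

End Flat.

Lemma of_class_C_flat (R : realType) (n k m : nat) (U : set 'rV[R]_n) (f : 'rV[R]_n -> R) :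
  open U -> of_class_C k U f -> of_class_C k U (fun x => flat m (f x)).
Proof.
move=> oU; have dflat j t : differentiable (@flat R j) t.
  by apply/derivable1_diffP; have [] := is_derive_flat j t.
elim: k m => [|k IH] m.
  move=> cf x Ux; apply: (@continuous_comp _ _ _ f (flat m)); first exact: cf.
  exact: differentiable_continuous.
move=> /[dup] /of_class_CW Cf [df Df].
split=> [x Ux|i].
  by apply: (@differentiable_comp _ _ _ _ f (flat m)); [exact: df|].
have IHf j := IH j Cf.
have := of_class_CM oU (Df i) (of_class_CB oU (IHf m.+2)
  (of_class_CM oU (of_class_C_cst k U (m%:R : R)) (IHf m.+1))).
apply: of_class_C_eq => // x Ux /=.
apply: etrans (esym (derive_comp_real (dirvec i) (df x Ux) (dflat m (f x)))).
by have [_ ->] := is_derive_flat m (f x).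
Qed.

(** * Charts *)

Section Charts.
Context {R : realType} {n : nat} {M : smooth_manifold R n}.
Implicit Types (c d e : chart M) (p q : M) (V : set M).

Definition chart_image c V : set 'rV[R]_n := chart_map c @` (dom c `&` V).

Lemma chart_imageT c : chart_image c setT = chart_map c @` dom c.
Proof. by rewrite /chart_image setIT. Qed.

Lemma open_chart_image c V : open V -> open (chart_image c V).
Proof.
move=> oV; rewrite openE => _ [p [dp Vp] <-].
have img : (chart_map c @` dom c) (chart_map c p) by exists p.
have nI : nbhs (chart_map c p) (chart_map c @` dom c).
  by apply: open_nbhs_nbhs; split; [exact: chart_map_open|].
have nV : nbhs (chart_inv c (chart_map c p)) V.
  by rewrite chart_mapK //; apply: open_nbhs_nbhs.
have nP : \forall y \near chart_map c p, V (chart_inv c y).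
  exact: (chart_inv_continuous img nV).
apply: filterS (filterI nI nP) => y [[q dq <-]].
by rewrite chart_mapK // => Vq; exists q.
Qed.

Lemma nbhs_chart_image c p V : open V -> V p -> dom c p ->
  nbhs (chart_map c p) (chart_image c V).
Proof.
move=> oV Vp dp; apply: open_nbhs_nbhs; split; first exact: open_chart_image.
by exists p.
Qed.

Lemma chart_invK c y : (chart_map c @` dom c) y -> chart_map c (chart_inv c y) = y.
Proof. by move=> [q dq <-]; rewrite chart_mapK. Qed.

Lemma near_chart c p (P : M -> Prop) : dom c p -> (\forall q \near p, P q) ->
  \forall y \near chart_map c p, P (chart_inv c y).
Proof.
move=> dp nP; have img : (chart_map c @` dom c) (chart_map c p) by exists p.
have := chart_inv_continuous img; rewrite /prop_for /continuous_at chart_mapK //.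
by apply.
Qed.

Lemma near_dom c p : dom c p -> \forall q \near p, dom c q.
Proof. by move=> dp; apply: open_nbhs_nbhs; split=> //; exact: dom_open. Qed.

Lemma dir_deriv_near_eq (W : normedModType R) c v (F G : M -> W) p : dom c p ->
  (\forall q \near p, F q = G q) -> dir_deriv c v F p = dir_deriv c v G p.
Proof. by move=> dp /(near_chart dp) FG; apply: near_eq_derive. Qed.

Lemma transition_differentiable c d p : dom c p -> dom d p ->
  differentiable (chart_map d \o chart_inv c) (chart_map c p).
Proof.
by move=> dp ep; have [+ _] := transition_smooth c d 1%N; apply; exists p.
Qed.

Lemma dir_deriv_chart_map c d v p : dom c p -> dom d p ->
  dir_deriv c v (chart_map d) p = v *m transition_jacobian c d p.
Proof.
move=> dp ep; rewrite /dir_deriv deriveEjacobian //.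
exact: transition_differentiable.
Qed.

Lemma near_transition (W : Type) c d p (F : M -> W) : dom c p -> dom d p ->
  \forall y \near chart_map c p,
    ((F \o chart_inv d) \o (chart_map d \o chart_inv c)) y = (F \o chart_inv c) y.
Proof.
move=> dp ep; apply: filterS (near_chart dp (near_dom ep)) => y dy /=.
by rewrite chart_mapK.
Qed.

(** Near p, the expression of [F] in chart [c] is its expression in chart [d] composed with the
    transition map; the chain rule does the rest. *)
Lemma dir_deriv_change (W : normedModType R) c d v p (F : M -> W) :
  dom c p -> dom d p -> differentiable (F \o chart_inv d) (chart_map d p) ->
  dir_deriv c v F p = dir_deriv d (v *m transition_jacobian c d p) F p.
Proof.
move=> dp ep dF; rewrite -dir_deriv_chart_map //.
rewrite /dir_deriv -(near_eq_derive _ (near_transition F dp ep)).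
rewrite derive_comp_rV ?[in RHS]/=; last 2 first.
- exact: transition_differentiable.
- by rewrite /= chart_mapK.
by rewrite /= chart_mapK.
Qed.

Lemma row_mulP (a b : nat) (A B : 'M[R]_(a, b)) :
  (forall v : 'rV[R]_a, v *m A = v *m B) -> A = B.
Proof. by move=> AB; apply/row_matrixP => i; rewrite !rowE AB. Qed.

Lemma transition_jacobian_comp c d e p : dom c p -> dom d p -> dom e p ->
  transition_jacobian c d p *m transition_jacobian d e p = transition_jacobian c e p.
Proof.
move=> cp dp ep; apply: row_mulP => v.
have dT := transition_differentiable dp ep.
(* Here the differentiated function is the coordinate map of [e] itself. *)
have := dir_deriv_change v cp dp dT.
rewrite (dir_deriv_chart_map _ cp ep) (dir_deriv_chart_map _ dp ep) => ->.
by rewrite mulmxA.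
Qed.

Lemma transition_jacobian_id c p : dom c p -> transition_jacobian c c p = 1%:M.
Proof.
move=> cp; apply: row_mulP => v; apply: etrans (esym (dir_deriv_chart_map v cp cp)) _.
rewrite mulmx1 /dir_deriv -[RHS](derive_id (chart_map c p) v); apply: near_eq_derive.
have : nbhs (chart_map c p) (chart_image c setT).
  by apply: nbhs_chart_image => //; exact: openT.
by apply: filterS => y; rewrite chart_imageT => Iy /=; rewrite chart_invK.
Qed.

Lemma mulmx1_invmx (a : nat) (A B : 'M[R]_a) : A *m B = 1%:M -> A = invmx B.
Proof.
by move=> /[dup] AB /mulmx1_unit[_ uB]; rewrite -[LHS](mulmxK uB) AB mul1mx.
Qed.

Lemma transition_jacobianK c d p : dom c p -> dom d p ->
  transition_jacobian c d p *m transition_jacobian d c p = 1%:M.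
Proof.
by move=> cp dp; rewrite transition_jacobian_comp // transition_jacobian_id.
Qed.

Lemma transition_jacobian_inv c d p : dom c p -> dom d p ->
  transition_jacobian c d p = invmx (transition_jacobian d c p).
Proof. by move=> cp dp; exact: mulmx1_invmx (transition_jacobianK cp dp). Qed.

Lemma transition_jacobian_unit c d p : dom c p -> dom d p ->
  transition_jacobian c d p \in unitmx.
Proof.
by move=> cp dp; case: (mulmx1_unit (transition_jacobianK cp dp)) => u _; exact: u.
Qed.

(** Regularity without any transformation law, so that it also applies to metric coefficients and to
    iterated derivatives of components, which are not fields. *)
Definition smooth_in_charts (W : normedModType R) V (F : chart M -> M -> W) :=
  forall c, smooth_on (chart_image c V) (F c \o chart_inv c).

Lemma smooth_in_chartsW (W : normedModType R) V (F : chart M -> M -> W) :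
  smooth_in_charts setT F -> smooth_in_charts V F.
Proof.
move=> sF c k; apply: of_class_C_sub (sF c k).
by move=> _ [p [dp Vp] <-]; exists p.
Qed.

Lemma smooth_in_charts_differentiable (W : normedModType R) V (F : chart M -> M -> W) c p :
  smooth_in_charts V F -> V p -> dom c p ->
  differentiable (F c \o chart_inv c) (chart_map c p).
Proof. by move=> sF Vp dp; have [+ _] := sF c 1%N; apply; exists p. Qed.

Lemma smooth_in_charts_deriv (a b : nat) V (X : chart M -> M -> 'rV[R]_n)
    (F : chart M -> M -> 'M[R]_(a, b)) : open V ->
  smooth_in_charts V X -> smooth_in_charts V F ->
  smooth_in_charts V (fun c q => dir_deriv c (X c q) (F c) q).
Proof.
move=> oV sX sF c k; have oI : open (chart_image c V) := open_chart_image oV.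
apply/of_class_C_mxP => // i j.
have [dF DF] := sF c k.+1; have CX := sX c k.
pose S y := \sum_l (X c \o chart_inv c) y 0 l * ('D_(dirvec l) (F c \o chart_inv c) y) i j.
apply: (@of_class_C_eq _ _ _ _ _ S) => [//|y Iy|].
  have [q [dq Vq] qy] := Iy; rewrite /= /dir_deriv chart_invK; last by exists q.
  rewrite [in RHS]derive_sum_dirvec; last exact: dF.
  by rewrite summxE; apply: eq_bigr => l _; rewrite mxE.
apply: of_class_C_sum => // l _; apply: of_class_CM => //.
  exact: of_class_C_comp_coord.
by apply: of_class_C_comp_coord => //; exact: DF.
Qed.

End Charts.

(** * Global fields with a prescribed value *)

Section FieldExtension.
Context {R : realType} {n : nat} {M : smooth_manifold R n}.
Implicit Types (c d e : chart M) (p q : M) (V : set M).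

Lemma of_class_C_transition_jacobian c d k :
  of_class_C k (chart_image c (dom d)) (fun y => transition_jacobian c d (chart_inv c y)).
Proof.
have oI : open (chart_image c (dom d)) := open_chart_image (@dom_open _ _ M d).
have [dT DT] := transition_smooth c d k.+1.
apply/of_class_C_mxP => // i j.
apply: of_class_C_eq (of_class_C_comp_coord 0 j oI (DT i)) => // y Iy.
have [q [cq dq] qy] := Iy.
have cIy : (chart_map c @` dom c) y by exists q.
rewrite /transition_jacobian chart_invK // deriveEjacobian; last exact: dT.
by rewrite -rowE mxE.
Qed.

Variables (c : chart M) (p : M).
Hypothesis cp : dom c p.

(** Sums of squares give a polynomial; the norm of row vectors is the maximum norm, which is not
    smooth. *)
Definition bump_arg (r : R) (y : 'rV[R]_n) : R :=
  r ^+ 2 - \sum_i (y 0 i - chart_map c p 0 i) ^+ 2.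

Lemma of_class_C_bump_arg r k U : open U -> of_class_C k U (bump_arg r).
Proof.
move=> oU; apply: of_class_CB => //; first exact: of_class_C_cst.
apply: of_class_C_sum => // i _.
have C1 : of_class_C k U (fun y => y 0 i - chart_map c p 0 i).
  by apply: of_class_CB => //; [exact: of_class_C_coord|exact: of_class_C_cst].
by apply: of_class_C_eq (of_class_CM oU C1 C1) => // y _; rewrite expr2.
Qed.

Lemma bump_arg_ge0 r y : 0 <= r -> 0 <= bump_arg r y -> `|y - chart_map c p| <= r.
Proof.
move=> r0; rewrite subr_ge0 => S_le.
rewrite /Num.Def.normr /= mx_normrE; apply: bigmax_le => // -[i j] _ /=.
rewrite !mxE (ord1 i) -(ler_pXn2r (ltn0Sn 1)) ?nnegrE //.
rewrite real_normK ?num_real //; apply: le_trans S_le.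
by rewrite (bigD1 j) //= lerDl sumr_ge0 // => k _; rewrite sqr_ge0.
Qed.

Lemma bump_radius : exists2 r : R, 0 < r &
  forall y, 0 <= bump_arg r y -> (chart_map c @` dom c) y.
Proof.
have nI : nbhs (chart_map c p) (chart_map c @` dom c).
  by apply: open_nbhs_nbhs; split; [exact: chart_map_open|exists p].
have /nbhs_ballP[r /= r0 rI] := nI.
exists (r / 2) => [|y y0]; first by rewrite divr_gt0.
apply: rI; rewrite -ball_normE /ball_ /= distrC.
apply: (le_lt_trans (bump_arg_ge0 _ y0)); first by rewrite divr_ge0 // ltW.
by rewrite ltr_pdivrMr // ltr_pMr // ltr1n.
Qed.

Definition bump_support r : set M := chart_inv c @` [set y | 0 <= bump_arg r y].

(** A continuous image of a compact ball is compact, hence closed: this is where the Hausdorff axiom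
    enters. *)
Lemma closed_bump_support r : 0 < r ->
  (forall y, 0 <= bump_arg r y -> (chart_map c @` dom c) y) -> closed (bump_support r).
Proof.
move=> r0 rI; apply: compact_closed; first exact: (@manifold_hausdorff _ _ M).
apply: continuous_compact.
  apply: continuous_in_subspaceT => y; rewrite inE /= => y0.
  exact: chart_inv_continuous (rI _ y0).
apply: bounded_closed_compact.
  exists (r + `|chart_map c p|); split; first exact: num_real.
  move=> N /ltW rN y y0 /=; apply: le_trans rN.
  rewrite -[y](subrK (chart_map c p)); apply: le_trans (ler_normD _ _) _.
  by rewrite lerD2r; apply: bump_arg_ge0 y0; exact: ltW.
have cQ : continuous (bump_arg r).
  move=> y; apply: (of_class_C_continuous (k := 0) (U := setT)) => //.
  by apply: of_class_C_bump_arg; exact: openT.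
apply: (@closed_comp _ _ (bump_arg r) [set x | 0 <= x]) => //.
Qed.

Lemma smooth_field_through v : exists2 X : field M, smooth_field X & X c p = v.
Proof.
have [r r0 rI] := bump_radius.
pose b q : R := flat 0 (bump_arg r (chart_map c q)).
have bp : b p != 0.
  rewrite /b /bump_arg big1 => [|i _]; last by rewrite subrr expr0n.
  rewrite subr0 /flat exprn_gt0 // expr0 mul1r gt_eqF //; exact: expR_gt0.
(* The vector, constant in chart [c], is cut off and divided by the value of the cutoff at [p]. Off
   [dom c] the Jacobian from [c] has no meaning, hence the case distinction. *)
pose X : field M := fun d q => if pselect (dom c q) is left _ then
  b q *: (((b p)^-1 *: v) *m transition_jacobian c d q) else 0.
have XE d q : dom c q -> X d q = b q *: (((b p)^-1 *: v) *m transition_jacobian c d q).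
  by move=> cq; rewrite /X; case: pselect.
have X0 d q : ~ bump_support r q -> X d q = 0.
  move=> nq; rewrite /X; case: pselect => // cq; rewrite /b /flat ifF ?scale0r //.
  apply/negbTE; apply/negP => y0; apply: nq.
  by exists (chart_map c q); rewrite /= ?ltW // chart_mapK.
exists X; last by rewrite XE // transition_jacobian_id // mulmx1 scalerA mulfV // scale1r.
split=> [d e q _ dq eq_|d k].
  rewrite /X; case: pselect => [cq|_]; last by rewrite mul0mx.
  have scaleE s (w : 'rV[R]_n) (A B C : 'M[R]_n) : A *m B = C ->
    s *: (w *m C) = s *: (w *m A) *m B by move=> <-; rewrite mulmxA scalemxAl.
  exact: scaleE (transition_jacobian_comp cq dq eq_).
apply: of_class_C_local => _ [q [dq _] <-].
(* Smoothness is local: a point off [dom c] has the open complement of the support as a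
   neighbourhood, where the field is zero; [dom c] serves for the other points. *)
have [cq|ncq] := pselect (dom c q); last first.
  have oS : open (~` bump_support r) by apply: closed_openC; exact: closed_bump_support.
  exists (chart_image d (~` bump_support r)).
    exists q => //; split=> // -[y y0 yq]; apply: ncq; rewrite -yq.
    by have [q' cq' <-] := rI _ y0; rewrite chart_mapK.
  apply: of_class_C_eq (of_class_C_cst k _ 0).
    exact: open_chart_image oS.
  by move=> _ [q' [dq' nq'] <-]; rewrite /= X0 // chart_mapK.
have oI : open (chart_image d (dom c)) := open_chart_image (@dom_open _ _ M c).
exists (chart_image d (dom c)); first by exists q.
(* The Jacobian from [c] to [d] is known to be smooth in the coordinates of [c], while [y] lives in
   those of [d]; so it is written as the inverse of the Jacobian from [d] to [c]. *)
pose Y y := flat 0 ((bump_arg r \o (chart_map c \o chart_inv d)) y) *: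
  (((b p)^-1 *: v) *m invmx (transition_jacobian d c (chart_inv d y))).
apply: (@of_class_C_eq _ _ _ _ _ Y) => [//|y [q' [dq' cq'] <-]|].
  rewrite /Y /= chart_mapK // XE //; congr (_ *: (_ *m _)).
  exact/esym/transition_jacobian_inv.
apply: of_class_C_mxZ => //.
  apply: of_class_C_flat => //.
  apply: (@of_class_C_comp _ _ _ _ setT) => //.
    by apply: of_class_C_bump_arg; exact: openT.
  exact: transition_smooth.
apply: of_class_C_mulmx => //; first exact: of_class_C_cst.
apply: of_class_C_invmx => //; last exact: of_class_C_transition_jacobian.
move=> _ [q' [dq' cq'] <-]; rewrite chart_mapK //.
exact: transition_jacobian_unit.
Qed.

End FieldExtension.

(** * Lie brackets and the Koszul formula *)

Section Brackets.
Context {R : realType} {n : nat} {M : smooth_manifold R n}.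
Implicit Types (c d e : chart M) (p q : M) (V : set M) (X Y Z : field M).

(** The double sum is the Hessian of [F] on [v] and [Y]. Being symmetric, it drops out of the
    commutator in the next lemma. *)
Lemma dir_deriv_deriv V Y (F : chart M -> M -> R) c p v : open V -> V p -> dom c p ->
  smooth_in_charts V Y -> smooth_in_charts V F ->
  dir_deriv c v (fun q => dir_deriv c (Y c q) (F c) q) p =
  dir_deriv c (dir_deriv c v (Y c) p) (F c) p +
  \sum_l \sum_k Y c p 0 l *
    (v 0 k * 'D_(dirvec k) ('D_(dirvec l) (F c \o chart_inv c)) (chart_map c p)).
Proof.
move=> oV Vp dp sY sF; set f := F c \o chart_inv c; set x := chart_map c p.
have Ix : chart_image c V x by exists p.
have nI : nbhs x (chart_image c V) by exact: nbhs_chart_image.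
have [df Df] := sF c 2%N; rewrite -/f in df Df.
have dY := smooth_in_charts_differentiable sY Vp dp.
pose Yl l := fun y => (Y c \o chart_inv c) y 0 l.
have dYl l : differentiable (Yl l) x.
  have C1 : of_class_C 1 (chart_image c V) (Yl l).
    by apply: of_class_C_comp_coord (sY c 1%N); exact: open_chart_image.
  by case: C1 => + _; apply.
have dDf l : differentiable ('D_(dirvec l) f) x by case: (Df l) => + _; apply.
have nE : \forall y \near x, ((fun q => dir_deriv c (Y c q) (F c) q) \o chart_inv c) y =
    (\sum_l (Yl l * 'D_(dirvec l) f)) y.
  apply: filterS nI => y Iy; have [q [dq Vq] qy] := Iy.
  rewrite /= /dir_deriv chart_invK; last by exists q.
  rewrite derive_sum_dirvec; last exact: df.
  by rewrite fct_sumE; apply: eq_bigr.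
rewrite /dir_deriv (near_eq_derive _ nE) derive_sum; last first.
  by move=> l; apply: derivableM; apply: diff_derivable.
rewrite [X in _ = X + _]derive_sum_dirvec; last exact: df.
rewrite -big_split; apply: eq_bigr => l _ /=.
rewrite deriveM; [|exact: diff_derivable (dYl l)|exact: diff_derivable (dDf l)].
rewrite [LHS]addrC; congr (_ + _).
  rewrite -[LHS]/(_ * _) -[RHS]/(_ * _) mulrC; congr (_ * _).
  rewrite derive_mx ?mxE //; exact: diff_derivable.
rewrite -mulr_sumr /Yl /= chart_mapK // -[LHS]/(_ * _); congr (_ * _).
by rewrite derive_sum_dirvec.
Qed.

Lemma bracket_deriv_scalar V X Y (F : chart M -> M -> R) c p : open V -> V p -> dom c p ->
  smooth_in_charts V X -> smooth_in_charts V Y -> smooth_in_charts V F ->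
  dir_deriv c (X c p) (fun q => dir_deriv c (Y c q) (F c) q) p -
  dir_deriv c (Y c p) (fun q => dir_deriv c (X c q) (F c) q) p =
  dir_deriv c (lie_bracket X Y c p) (F c) p.
Proof.
move=> oV Vp dp sX sY sF.
rewrite (dir_deriv_deriv _ oV Vp dp sY sF) (dir_deriv_deriv _ oV Vp dp sX sF).
have dF := smooth_in_charts_differentiable sF Vp dp.
pose D2 l k := 'D_(dirvec k) ('D_(dirvec l) (F c \o chart_inv c)) (chart_map c p).
have D2C l k : D2 l k = D2 k l.
  by apply: (derive_comm_scalar _ _ (open_chart_image oV) _ (sF c 2%N)); exists p.
have SS : \sum_l \sum_k Y c p 0 l * (X c p 0 k * D2 l k) =
    \sum_l \sum_k X c p 0 l * (Y c p 0 k * D2 l k).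
  rewrite exchange_big; apply: eq_bigr => l _; apply: eq_bigr => k _.
  by rewrite mulrCA D2C.
move: SS; rewrite /D2 => ->; move: (\sum_l _) => S.
rewrite opprD addrACA (subrr S) addr0.
by rewrite /dir_deriv !(deriveE _ dF) linearB.
Qed.

Lemma bracket_deriv V X Y (a b : nat) (F : chart M -> M -> 'M[R]_(a, b)) c p :
  open V -> V p -> dom c p ->
  smooth_in_charts V X -> smooth_in_charts V Y -> smooth_in_charts V F ->
  dir_deriv c (X c p) (fun q => dir_deriv c (Y c q) (F c) q) p -
  dir_deriv c (Y c p) (fun q => dir_deriv c (X c q) (F c) q) p =
  dir_deriv c (lie_bracket X Y c p) (F c) p.
Proof.
move=> oV Vp dp sX sY sF; apply/matrixP => i j.
pose Fij e q := F e q i j.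
have sFij : smooth_in_charts V Fij.
  by move=> e k; apply: of_class_C_comp_coord (sF e k); exact: open_chart_image.
have swap v Z : smooth_in_charts V Z ->
    dir_deriv c v (fun q => dir_deriv c (Z c q) (F c) q) p i j =
    dir_deriv c v (fun q => dir_deriv c (Z c q) (Fij c) q) p.
  move=> sZ; have sDF := smooth_in_charts_deriv oV sZ sF.
  rewrite dir_deriv_entry; last exact: smooth_in_charts_differentiable sDF Vp dp.
  apply: dir_deriv_near_eq => //; near=> q; apply: dir_deriv_entry.
  apply: (smooth_in_charts_differentiable sF); near: q; last exact: near_dom.
  exact: open_nbhs_nbhs.
rewrite [RHS]dir_deriv_entry; last exact: smooth_in_charts_differentiable sF Vp dp.
apply: etrans (bracket_deriv_scalar oV Vp dp sX sY sFij).
have subE (A B : 'M[R]_(a, b)) : (A - B) i j = A i j - B i j by rewrite !mxE.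
by rewrite subE; congr (_ - _); [exact: (swap _ Y sY)|exact: (swap _ X sX)].
Unshelve. all: by end_near. Qed.

(** By [bracket_deriv], a derivative along a bracket is a commutator of iterated derivatives; each
    of the six iterated derivatives then occurs twice, with opposite signs. *)
Lemma jacobi X Y Z c p : dom c p ->
  smooth_in_charts setT X -> smooth_in_charts setT Y -> smooth_in_charts setT Z ->
  lie_bracket X (lie_bracket Y Z) c p + lie_bracket Y (lie_bracket Z X) c p +
  lie_bracket Z (lie_bracket X Y) c p = 0.
Proof.
move=> dp sX sY sZ.
have T A B C : smooth_in_charts setT A -> smooth_in_charts setT B ->
    smooth_in_charts setT C -> lie_bracket A (lie_bracket B C) c p =
    dir_deriv c (A c p) (fun q => dir_deriv c (B c q) (C c) q) p -
    dir_deriv c (A c p) (fun q => dir_deriv c (C c q) (B c) q) p -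
    dir_deriv c (lie_bracket B C c p) (A c) p.
  move=> sA sB sC; rewrite {1}/lie_bracket; congr (_ - _).
  have dBC := smooth_in_charts_differentiable (smooth_in_charts_deriv openT sB sC) I dp.
  have dCB := smooth_in_charts_differentiable (smooth_in_charts_deriv openT sC sB) I dp.
  by rewrite /dir_deriv -deriveB //; apply: diff_derivable.
rewrite !T // -!(bracket_deriv openT I dp) //.
move: (dir_deriv c (X c p) (fun q => dir_deriv c (Y c q) (Z c) q) p)
  (dir_deriv c (X c p) (fun q => dir_deriv c (Z c q) (Y c) q) p)
  (dir_deriv c (Y c p) (fun q => dir_deriv c (Z c q) (X c) q) p)
  (dir_deriv c (Z c p) (fun q => dir_deriv c (Y c q) (X c) q) p)
  (dir_deriv c (Y c p) (fun q => dir_deriv c (X c q) (Z c) q) p)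
  (dir_deriv c (Z c p) (fun q => dir_deriv c (X c q) (Y c) q) p) => a1 a2 a3 a4 a5 a6.
by apply/rowP => k; rewrite !mxE; ring.
Qed.

(** The components of a field in chart [d] are the derivatives of [chart_map d] along it. So the law
    is [bracket_deriv] applied to [chart_map d], read in chart [c]. *)
Lemma lie_bracket_change X Y c d p : smooth_field X -> smooth_field Y ->
  dom c p -> dom d p ->
  lie_bracket X Y d p = lie_bracket X Y c p *m transition_jacobian c d p.
Proof.
move=> sX sY cp dp; have [lX cX] := sX; have [lY cY] := sY.
have oD : open (dom d) by exact: dom_open.
pose T (e : chart M) := chart_map d.
have sT : smooth_in_charts (dom d) T by move=> e; exact: transition_smooth.
rewrite -(dir_deriv_chart_map _ cp dp).
have := bracket_deriv (F := T) oD dp cp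
  (@smooth_in_chartsW _ _ _ _ _ _ cX) (@smooth_in_chartsW _ _ _ _ _ _ cY) sT.
move=> brT; apply: (etrans _ brT).
have law A B : smooth_field A -> smooth_field B ->
    dir_deriv d (A d p) (B d) p =
    dir_deriv c (A c p) (fun q => dir_deriv c (B c q) (T c) q) p.
  move=> [lA cA] [lB cB]; rewrite (lA c d p I cp dp).
  have dB := smooth_in_charts_differentiable cB I dp.
  apply: etrans (esym (dir_deriv_change (A c p) cp dp dB)) _.
  apply: dir_deriv_near_eq => //; near=> q.
  have dq : dom d q by near: q; exact: near_dom.
  have cq : dom c q by near: q; exact: near_dom.
  by rewrite /T (dir_deriv_chart_map _ cq dq); exact: lB.
by rewrite {1}/lie_bracket (law _ _ sX sY) (law _ _ sY sX).
Unshelve. all: by end_near. Qed.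

Lemma smooth_lie_bracket X Y : smooth_field X -> smooth_field Y ->
  smooth_field (lie_bracket X Y).
Proof.
move=> sX sY; split=> [c d p _ cp dp|c]; first exact: lie_bracket_change.
have [_ cX] := sX; have [_ cY] := sY => k.
apply: of_class_C_mxB; first exact: open_chart_image openT.
  exact: (smooth_in_charts_deriv openT cX cY).
exact: (smooth_in_charts_deriv openT cY cX).
Qed.

End Brackets.

(** * Chart independence of the covariant derivative *)

Section InnerProduct.
Context {R : realType} {n : nat} {M : smooth_manifold R n}.
Variable g : riemannian_metric M.
Implicit Types (c d e : chart M) (p q : M) (V : set M) (X Y Z : field M)
  (u v w : 'rV[R]_n).

Definition gdot c p u v : R := (u *m gram g c p *m v^T) 0 0.

Lemma gdotDl c p u v w : gdot c p (u + v) w = gdot c p u w + gdot c p v w.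
Proof. by rewrite /gdot !mulmxDl mxE. Qed.

Lemma gdotZl c p a u w : gdot c p (a *: u) w = a * gdot c p u w.
Proof. by rewrite /gdot -!scalemxAl mxE. Qed.

Lemma gdotNl c p u w : gdot c p (- u) w = - gdot c p u w.
Proof. by rewrite -scaleN1r gdotZl mulN1r. Qed.

Lemma gdotBl c p u v w : gdot c p (u - v) w = gdot c p u w - gdot c p v w.
Proof. by rewrite gdotDl gdotNl. Qed.

Lemma gdot0l c p w : gdot c p 0 w = 0.
Proof. by rewrite /gdot !mul0mx mxE. Qed.

Lemma gdotC c p u v : dom c p -> gdot c p u v = gdot c p v u.
Proof.
move=> dp; rewrite /gdot; have -> : u *m gram g c p *m v^T = (v *m gram g c p *m u^T)^T.
  by rewrite !trmx_mul trmxK (gram_sym g dp) mulmxA.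
by rewrite mxE.
Qed.

Lemma gdot_gt0 c p u : dom c p -> u != 0 -> 0 < gdot c p u u.
Proof. by move=> dp; exact: gram_pos. Qed.

Lemma gdot_inj c p u v : dom c p ->
  (forall w, gdot c p u w = gdot c p v w) -> u = v.
Proof.
move=> dp uv; apply/eqP; rewrite -subr_eq0; apply/negPn/negP => n0.
by have := gdot_gt0 dp n0; rewrite gdotBl uv subrr ltxx.
Qed.

Lemma gdot_change c d p u v : dom c p -> dom d p ->
  gdot d p (u *m transition_jacobian c d p) (v *m transition_jacobian c d p) =
  gdot c p u v.
Proof.
by move=> cp dp; rewrite /gdot (gram_change g cp dp) trmx_mul !mulmxA.
Qed.

Lemma smooth_in_charts_gram : smooth_in_charts setT (gram g).
Proof. by move=> c; rewrite chart_imageT; exact: gram_smooth. Qed.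

Lemma smooth_in_charts_inner V X Y : open V ->
  smooth_in_charts V X -> smooth_in_charts V Y -> smooth_in_charts V (inner g X Y).
Proof.
move=> oV sX sY c k; have oI : open (chart_image c V) := open_chart_image oV.
have sG := @smooth_in_chartsW _ _ _ _ V _ smooth_in_charts_gram.
apply: (of_class_C_comp_coord (F := fun y => _) 0 0 oI).
apply: of_class_C_mulmx => //; last exact: of_class_C_trmx (sY c k).
apply: of_class_C_mulmx => //; [exact: sX|exact: sG].
Qed.

Lemma inner_change X Y c d p : smooth_field X -> smooth_field Y ->
  dom c p -> dom d p -> inner g X Y c p = inner g X Y d p.
Proof.
move=> [lX _] [lY _] cp dp; rewrite -[RHS]/(gdot d p _ _).
by rewrite (lX c d p I cp dp) (lY c d p I cp dp) gdot_change.
Qed.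

Lemma deriv_inner_change X Y Z c d p : smooth_field X -> smooth_field Y ->
  smooth_field Z -> dom c p -> dom d p ->
  dir_deriv c (Z c p) (inner g X Y c) p = dir_deriv d (Z d p) (inner g X Y d) p.
Proof.
move=> sX sY [lZ _] cp dp; have [_ cX] := sX; have [_ cY] := sY.
have dXY := smooth_in_charts_differentiable (smooth_in_charts_inner openT cX cY) I dp.
rewrite (lZ c d p I cp dp); have D := dir_deriv_change (Z c p) cp dp dXY.
apply: (etrans _ D).
apply: dir_deriv_near_eq => //; near=> q; apply: inner_change => //.
  by near: q; exact: near_dom.
by near: q; exact: near_dom.
Unshelve. all: by end_near. Qed.

(** The right-hand side involves only derivatives of scalar functions, brackets and inner products,
    all known to be chart independent. This spares the transformation rule of the Christoffel
    symbols. *)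
Lemma koszul X Y Z c p : smooth_field X -> smooth_field Y -> smooth_field Z ->
  dom c p ->
  2 * inner g (nabla g X Y) Z c p =
    dir_deriv c (X c p) (inner g Y Z c) p + dir_deriv c (Y c p) (inner g X Z c) p
    - dir_deriv c (Z c p) (inner g X Y c) p
    + inner g (lie_bracket X Y) Z c p - inner g Y (lie_bracket X Z) c p
    - inner g X (lie_bracket Y Z) c p.
Proof.
move=> sX sY sZ dp; rewrite !nabla_metric //.
have br A B : smooth_field A -> smooth_field B ->
    lie_bracket A B c p = nabla g A B c p - nabla g B A c p.
  by move=> sA sB; rewrite nabla_torsion_free.
have C u v := gdotC u v dp.
rewrite -![inner _ _ _ _ _]/(gdot c p _ _) !br //.
rewrite ![gdot c p (Y c p) _]C ![gdot c p (X c p) _]C !gdotBl; ring.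
Qed.

Lemma nabla_change X Y c d p : smooth_field X -> smooth_field Y ->
  dom c p -> dom d p -> nabla g X Y d p = nabla g X Y c p *m transition_jacobian c d p.
Proof.
move=> sX sY cp dp; apply: (gdot_inj dp) => w.
have [Z sZ Zw] := smooth_field_through dp w; have [lZ _] := sZ.
rewrite -Zw [in RHS](lZ c d p I cp dp) gdot_change //.
have two0 : (2 : R) != 0 by rewrite pnatr_eq0.
apply: (mulfI two0); rewrite -[gdot d p _ _]/(inner g (nabla g X Y) Z d p).
rewrite -[gdot c p _ _]/(inner g (nabla g X Y) Z c p).
rewrite (koszul sX sY sZ dp) (koszul sX sY sZ cp).
have sXY := smooth_lie_bracket sX sY; have sXZ := smooth_lie_bracket sX sZ.
have sYZ := smooth_lie_bracket sY sZ.
rewrite (deriv_inner_change sY sZ sX cp dp) (deriv_inner_change sX sZ sY cp dp).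
rewrite (deriv_inner_change sX sY sZ cp dp) (inner_change sXY sZ cp dp).
by rewrite (inner_change sY sXZ cp dp) (inner_change sX sYZ cp dp).
Qed.

Lemma smooth_in_charts_nabla X Y :
  smooth_in_charts setT X -> smooth_in_charts setT Y ->
  smooth_in_charts setT (nabla g X Y).
Proof.
move=> sX sY c k; have oI : open (chart_image c setT) := open_chart_image openT.
have sG := smooth_in_charts_gram.
apply: of_class_C_mulmx => //; first exact: sX.
apply/of_class_C_mxP => // i j.
have cG : of_class_C k (chart_image c setT) (gram g c \o chart_inv c) by exact: sG.
have cY : of_class_C k (chart_image c setT) (Y c \o chart_inv c) by exact: sY.
have img y : chart_image c setT y -> chart_map c (chart_inv c y) = y.
  by rewrite chart_imageT; exact: chart_invK.
have sDG a b l : of_class_C k (chart_image c setT)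
    (fun y => dir_deriv c (dirvec l) (fun q => gram g c q a b) (chart_inv c y)).
  have [_ /(_ l)] := of_class_C_comp_coord a b oI (sG c k.+1).
  by apply: of_class_C_eq => // y Iy; rewrite /dir_deriv img.
have sDY : of_class_C k (chart_image c setT)
    (fun y => dir_deriv c (dirvec i) (Y c) (chart_inv c y) 0 j).
  apply: of_class_C_comp_coord => //; have [_ /(_ i)] := sY c k.+1.
  by apply: of_class_C_eq => // y Iy; rewrite /dir_deriv img.
have sGam b l : of_class_C k (chart_image c setT)
    (fun y => christoffel g c (chart_inv c y) j b l).
  apply: of_class_CM => //; first exact: of_class_C_cst.
  apply: of_class_C_sum => // m _; apply: of_class_CM => //; last first.
    apply: of_class_CB => //; apply: of_class_CD => //.
  apply: of_class_C_comp_coord => //; apply: of_class_C_invmx => //.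
  by move=> _ [q [dq _] <-]; rewrite /= chart_mapK //; exact: gram_unit.
pose S y := dir_deriv c (dirvec i) (Y c) (chart_inv c y) 0 j
  + \sum_l christoffel g c (chart_inv c y) j i l * Y c (chart_inv c y) 0 l.
apply: (@of_class_C_eq _ _ _ _ _ S) => [//|y _|]; first by rewrite mxE.
apply: of_class_CD => //; apply: of_class_C_sum => // l _; apply: of_class_CM => //.
exact: of_class_C_comp_coord cY.
Qed.

Lemma smooth_nabla X Y : smooth_field X -> smooth_field Y -> smooth_field (nabla g X Y).
Proof.
move=> sX sY; split=> [c d p _ cp dp|]; first exact: nabla_change.
by have [_ cX] := sX; have [_ cY] := sY; exact: smooth_in_charts_nabla.
Qed.

End InnerProduct.

(** * Curvature *)

Section Curvature.
Context {R : realType} {n : nat} {M : smooth_manifold R n}.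
Variable g : riemannian_metric M.
Implicit Types (c d : chart M) (p q : M) (V : set M) (X Y Z W e : field M)
  (u v w : 'rV[R]_n).

Lemma gdotDr c p u v w : dom c p -> gdot g c p w (u + v) = gdot g c p w u + gdot g c p w v.
Proof. by move=> dp; rewrite gdotC // gdotDl !(gdotC _ w). Qed.

Lemma gdotZr c p a u w : dom c p -> gdot g c p w (a *: u) = a * gdot g c p w u.
Proof. by move=> dp; rewrite gdotC // gdotZl (gdotC _ w). Qed.

Lemma gdotNr c p u w : dom c p -> gdot g c p w (- u) = - gdot g c p w u.
Proof. by move=> dp; rewrite gdotC // gdotNl (gdotC _ w). Qed.

Lemma gdotBr c p u v w : dom c p -> gdot g c p w (u - v) = gdot g c p w u - gdot g c p w v.
Proof. by move=> dp; rewrite gdotDr // gdotNr. Qed.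

(** Identities between fields hold on the chart domain only, so equal functions cannot simply be
    substituted under [nabla]. *)
Lemma nabla_ext X Y Y' c p : dom c p -> (forall q, dom c q -> Y c q = Y' c q) ->
  nabla g X Y c p = nabla g X Y' c p.
Proof.
move=> dp YY'; rewrite /nabla; congr (_ *m _); apply/matrixP => i k; rewrite !mxE.
by rewrite (dir_deriv_near _ dp YY') (YY' _ dp).
Qed.

Lemma nabla0 X c p : nabla g X (fun _ _ => 0) c p = 0.
Proof.
rewrite /nabla (_ : cov_matrix _ _ _ _ = 0) ?mulmx0 //; apply/matrixP => i k.
rewrite !mxE big1 => [|j _]; last by rewrite mxE mulr0.
by rewrite addr0 /dir_deriv derive_cst mxE.
Qed.

Lemma inner_differentiable X Y c p : smooth_field X -> smooth_field Y -> dom c p ->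
  differentiable (inner g X Y c \o chart_inv c) (chart_map c p).
Proof.
move=> [_ sX] [_ sY] dp.
exact: smooth_in_charts_differentiable (smooth_in_charts_inner g openT sX sY) I dp.
Qed.

Lemma deriv_inner_cst X Y c p v (a : R) : dom c p ->
  (forall q, dom c q -> inner g X Y c q = a) -> dir_deriv c v (inner g X Y c) p = 0.
Proof.
by move=> dp XYa; rewrite (dir_deriv_near _ dp XYa) /dir_deriv derive_cst.
Qed.

(** The derivative of the constant g(e0, e0) is twice this inner product. *)
Lemma nabla_unit e0 c p u : smooth_field e0 -> unit_field g e0 -> dom c p ->
  gdot g c p (u *m cov_matrix g e0 c p) (e0 c p) = 0.
Proof.
move=> s0 u0 dp; have [X sX Xp] := smooth_field_through dp u.
have := deriv_inner_cst (X c p) dp (u0 c); rewrite (nabla_metric g X s0 s0 dp).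
rewrite -![inner _ _ _ _ _]/(gdot g c p _ _) (gdotC _ (e0 c p)) // -Xp.
by move/eqP; rewrite -mulr2n mulrn_eq0 /= => /eqP.
Qed.

Definition skew_nabla e0 := forall c p, dom c p -> forall u v,
  gdot g c p (u *m cov_matrix g e0 c p) v = - gdot g c p u (v *m cov_matrix g e0 c p).

(** With metric compatibility and vanishing torsion, the derivatives of [X] and [Y] along [e0]
    cancel from the Killing identity. What is left depends on pointwise values, hence passes to
    arbitrary vectors. *)
Lemma killing_skewP e0 : smooth_field e0 -> killing_field g e0 <-> skew_nabla e0.
Proof.
move=> s0; have key X Y c p : smooth_field X -> smooth_field Y -> dom c p ->
    (dir_deriv c (e0 c p) (inner g X Y c) p =
     inner g (lie_bracket e0 X) Y c p + inner g X (lie_bracket e0 Y) c p) <->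
    gdot g c p (nabla g X e0 c p) (Y c p) = - gdot g c p (X c p) (nabla g Y e0 c p).
  move=> sX sY dp; rewrite (nabla_metric g e0 sX sY dp).
  rewrite -![inner _ _ _ _ _]/(gdot g c p _ _).
  rewrite -(nabla_torsion_free g s0 sX dp) -(nabla_torsion_free g s0 sY dp).
  rewrite gdotBl (gdotBr _ _ _ dp).
  move: (gdot _ _ _ _ _) (gdot _ _ _ _ _) (gdot _ _ _ _ _) (gdot _ _ _ _ _) => a b d e.
  by split=> E; lra.
split=> [kf c p dp u v|sk X Y sX sY c p dp].
  have [X sX Xp] := smooth_field_through dp u.
  have [Y sY Yp] := smooth_field_through dp v.
  by have /key := kf X Y sX sY c p dp; rewrite /nabla Xp Yp; apply.
by apply/key => //; exact: sk.
Qed.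

Lemma lie_bracketC X Y c p : lie_bracket Y X c p = - lie_bracket X Y c p.
Proof. by rewrite /lie_bracket opprB. Qed.

Lemma curvatureC X Y Z c p : curvature g Y X Z c p = - curvature g X Y Z c p.
Proof.
rewrite /curvature [nabla g (lie_bracket Y X) _ _ _]/nabla lie_bracketC mulNmx.
by rewrite -[_ *m _]/(nabla g (lie_bracket X Y) Z c p) opprK !opprB addrC addrA.
Qed.

Lemma nablaB X Y Y' c p : smooth_field Y -> smooth_field Y' -> dom c p ->
  nabla g X (fun c q => Y c q - Y' c q) c p = nabla g X Y c p - nabla g X Y' c p.
Proof.
move=> sY sY' dp; have dY := field_differentiable sY dp.
have dY' := field_differentiable sY' dp.
rewrite /nabla -mulmxBr; congr (_ *m _); apply/matrixP => i k; rewrite !mxE.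
rewrite {1}/dir_deriv deriveB; [|exact: diff_derivable|exact: diff_derivable].
rewrite !mxE -!/(dir_deriv _ _ _ _) opprD addrACA; congr (_ + _).
by rewrite -sumrB; apply: eq_bigr => j _; rewrite !mxE mulrBr.
Qed.

(** Vanishing torsion, used for the outer and the inner bracket, turns the Jacobi identity into this
    one. *)
Lemma bianchi X Y Z c p : smooth_field X -> smooth_field Y -> smooth_field Z ->
  dom c p ->
  curvature g X Y Z c p + curvature g Y Z X c p + curvature g Z X Y c p = 0.
Proof.
move=> sX sY sZ dp.
have [_ cX] := sX; have [_ cY] := sY; have [_ cZ] := sZ.
rewrite -(jacobi dp cX cY cZ).
have step A B C : smooth_field A -> smooth_field B -> smooth_field C ->
    lie_bracket A (lie_bracket B C) c p =
    nabla g A (nabla g B C) c p - nabla g A (nabla g C B) c p -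
    nabla g (lie_bracket B C) A c p.
  move=> sA sB sC; have sBC := smooth_lie_bracket sB sC.
  rewrite -(nabla_torsion_free g sA sBC dp); congr (_ - _).
  rewrite -nablaB //; [|exact: smooth_nabla|exact: smooth_nabla].
  apply: nabla_ext => // q dq; exact/esym/nabla_torsion_free.
rewrite (step _ _ _ sX sY sZ) (step _ _ _ sY sZ sX) (step _ _ _ sZ sX sY) /curvature.
apply/rowP => k; rewrite !mxE.
ring.
Qed.

(** The bracket of X and Y acts on the function g(Z, W) as a commutator. Expanding by metric
    compatibility, the terms with one derivative on each of Z and W cancel. *)
Lemma curvature_skew X Y Z W c p : smooth_field X -> smooth_field Y ->
  smooth_field Z -> smooth_field W -> dom c p ->
  gdot g c p (curvature g X Y Z c p) (W c p) =
  - gdot g c p (Z c p) (curvature g X Y W c p).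
Proof.
move=> sX sY sZ sW dp.
have [_ cX] := sX; have [_ cY] := sY; have [_ cZ] := sZ; have [_ cW] := sW.
have := bracket_deriv_scalar openT I dp cX cY (smooth_in_charts_inner g openT cZ cW).
have second A B : smooth_field A -> smooth_field B ->
    dir_deriv c (A c p) (fun q => dir_deriv c (B c q) (inner g Z W c) q) p =
    inner g (nabla g A (nabla g B Z)) W c p + inner g (nabla g B Z) (nabla g A W) c p
    + (inner g (nabla g A Z) (nabla g B W) c p + inner g Z (nabla g A (nabla g B W)) c p).
  move=> sA sB; have sBZ := smooth_nabla g sB sZ; have sBW := smooth_nabla g sB sW.
  rewrite -(nabla_metric g A sBZ sW dp) -(nabla_metric g A sZ sBW dp).
  have d1 := inner_differentiable sBZ sW dp; have d2 := inner_differentiable sZ sBW dp.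
  have dD : dir_deriv c (A c p) (fun q => inner g (nabla g B Z) W c q
        + inner g Z (nabla g B W) c q) p =
      dir_deriv c (A c p) (inner g (nabla g B Z) W c) p
      + dir_deriv c (A c p) (inner g Z (nabla g B W) c) p.
    exact: deriveD (diff_derivable d1) (diff_derivable d2).
  rewrite -dD; apply: dir_deriv_near => // q dq; exact: nabla_metric.
rewrite (second _ _ sX sY) (second _ _ sY sX).
rewrite (nabla_metric g (lie_bracket X Y) sZ sW dp) -![inner _ _ _ _ _]/(gdot g c p _ _).
rewrite /curvature !gdotBl !gdotBr // => E; lra.
Qed.

End Curvature.

(** * From Sasakian manifolds to congruences *)

Section Frames.
Context {R : realType} {M : smooth_manifold R 3}.
Variable g : riemannian_metric M.
Implicit Types (c d : chart M) (p q : M) (V : set M) (X Y Z : field M)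
  (u v w : 'rV[R]_3).

Lemma orthonormal_expansion c p u0 u1 u2 v : dom c p ->
  [/\ gdot g c p u0 u0 = 1, gdot g c p u1 u1 = 1 & gdot g c p u2 u2 = 1] ->
  [/\ gdot g c p u0 u1 = 0, gdot g c p u0 u2 = 0 & gdot g c p u1 u2 = 0] ->
  v = gdot g c p v u0 *: u0 + gdot g c p v u1 *: u1 + gdot g c p v u2 *: u2.
Proof.
move=> dp [n0 n1 n2] [z01 z02 z12].
pose E : 'M[R]_3 := \matrix_(i < 3) nth 0 [:: u0; u1; u2] i.
pose G := gram g c p.
have dotE w i : (w *m G *m E^T) 0 i = gdot g c p w (row i E).
  by rewrite /gdot -/G !mxE; apply: eq_bigr => j _; rewrite !mxE.
have EGE : E *m G *m E^T = 1%:M.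
  apply/row_matrixP => i; rewrite !row_mul; apply/rowP => j.
  rewrite dotE !rowK row1 mxE.
  have [z10 z20 z21] : [/\ gdot g c p u1 u0 = 0, gdot g c p u2 u0 = 0
      & gdot g c p u2 u1 = 0] by rewrite !(gdotC _ u1 u0) ?(gdotC _ u2).
  case: i => -[|[|[|i]]] ?; last by [].
  - case: j => -[|[|[|j]]] ?; by [].
  - case: j => -[|[|[|j]]] ?; by [].
  - case: j => -[|[|[|j]]] ?; by [].
have EE1 : G *m E^T *m E = 1%:M.
  (* A one-sided inverse of a square matrix is two-sided: orthonormality of the rows of [E] becomes
     completeness. *)
  have := congr1 trmx (mulmx1C EGE); rewrite trmx1 !trmx_mul trmxK.
  by rewrite (gram_sym g dp).
rewrite -[LHS]mulmx1 -EE1 !mulmxA mulmx_sum_row !big_ord_recl big_ord0 addr0.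
by rewrite !dotE !rowK /= addrA.
Qed.

Local Open Scope complex_scope.

(** On the plane of e1 and e2, up to sign and a factor 1/2, the real part of rho is the trace of
    this form, sigma its trace-free symmetric part and the twist its skew part. *)
Definition shape_form e c p u v : R := gdot g c p (u *m cov_matrix g e c p) v.

Lemma cinner_cnabla e c p u v :
  cinner g c p (cnabla g c p (cvec u) e) (cvec v) = (shape_form e c p u v)%:C.
Proof.
by rewrite /cinner /cnabla /cvec /cmat -!map_mxM map_trmx -map_mxM mxE.
Qed.

(** Both scalars are instances: t is -i in each, and s is i for rho and -i for sigma. *)
Lemma cinner_cnabla_expand e c p u v (s t : R[i]) :
  let k := ((Num.sqrt 2)^-1)%:C : R[i] in
  cinner g c p (cnabla g c p (k *: (cvec u + s *: cvec v)) e)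
     (k *: (cvec u + t *: cvec v)) =
  (2^-1)%:C * ((shape_form e c p u u)%:C + t * (shape_form e c p u v)%:C
    + s * (shape_form e c p v u)%:C + s * t * (shape_form e c p v v)%:C).
Proof.
move=> k; have kk : k * k = (2^-1)%:C.
  by rewrite -rmorphM /= -invfM -expr2 sqr_sqrtr.
rewrite -!cinner_cnabla -kk; pose h x y := cinner g c p (cnabla g c p x e) y.
have hDl x y z : h (x + y) z = h x z + h y z by rewrite /h /cinner /cnabla !mulmxDl mxE.
have hZl a x z : h (a *: x) z = a * h x z.
  by rewrite /h /cinner /cnabla -!scalemxAl mxE.
have hDr x y z : h z (x + y) = h z x + h z y.
  by rewrite /h /cinner linearD /= mulmxDr mxE.
have hZr a x z : h z (a *: x) = a * h z x.
  by rewrite /h /cinner linearZ /= -scalemxAr mxE.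
rewrite -!/(h _ _) hZl hZr hDl !hDr !hZl !hZr.
move: (h _ _) (h _ _) (h _ _) (h _ _) => h1 h2 h3 h4; ring.
Qed.

Lemma rho_eq e0 e1 e2 c p : rho g e0 e1 e2 c p =
  - (2^-1 * (shape_form e0 c p (e1 c p) (e1 c p) + shape_form e0 c p (e2 c p) (e2 c p)))
  +i* (2^-1 * (shape_form e0 c p (e1 c p) (e2 c p) - shape_form e0 c p (e2 c p) (e1 c p))).
Proof.
rewrite /rho /e_minus /e_plus -scaleNr cinner_cnabla_expand.
move: (shape_form _ _ _ _ _) (shape_form _ _ _ _ _) (shape_form _ _ _ _ _)
  (shape_form _ _ _ _ _) => a b d f.
by simpc; apply/eqP; rewrite eq_complex /=; apply/andP; split; apply/eqP; ring.
Qed.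

Lemma sigma_eq e0 e1 e2 c p : sigma g e0 e1 e2 c p =
  - (2^-1 * (shape_form e0 c p (e1 c p) (e1 c p) - shape_form e0 c p (e2 c p) (e2 c p)))
  +i* (2^-1 * (shape_form e0 c p (e1 c p) (e2 c p) + shape_form e0 c p (e2 c p) (e1 c p))).
Proof.
rewrite /sigma /e_plus -scaleNr cinner_cnabla_expand.
move: (shape_form _ _ _ _ _) (shape_form _ _ _ _ _) (shape_form _ _ _ _ _)
  (shape_form _ _ _ _ _) => a b d f.
by simpc; apply/eqP; rewrite eq_complex /=; apply/andP; split; apply/eqP; ring.
Qed.

End Frames.

(** * Unit fields with skew covariant derivative *)

Section SkewUnitField.
Context {R : realType} {n : nat} {M : smooth_manifold R n}.
Variables (g : riemannian_metric M) (e0 : field M).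
Hypotheses (s0 : smooth_field e0) (u0 : unit_field g e0) (sk : skew_nabla g e0).
Implicit Types (c d : chart M) (p q : M) (X Y Z : field M) (u v w : 'rV[R]_n).

(** By skewness g(phi e0, w) = -g(e0, phi w), which vanishes because e0 has constant length. *)
Lemma skew_nabla_geodesic c p : dom c p -> nabla g e0 e0 c p = 0.
Proof.
move=> dp; apply: (gdot_inj (g := g) dp) => w; rewrite gdot0l /nabla sk // gdotC //.
by rewrite (nabla_unit w s0 u0 dp) oppr0.
Qed.

Lemma skew_nabla_self c p u : dom c p -> gdot g c p (u *m cov_matrix g e0 c p) u = 0.
Proof.
move=> dp; have := sk dp u u; rewrite (gdotC _ u) // => /eqP.
by rewrite -addr_eq0 -mulr2n mulrn_eq0 /= => /eqP.
Qed.

(** The first term of the curvature vanishes since e0 is geodesic. Differentiating g(phi X, X) = 0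
    along e0 gives the second, and skewness moves phi off the bracket in the third; the derivatives
    of X along e0 then cancel. *)
Lemma curvature_skew_nabla X c p : smooth_field X -> dom c p ->
  gdot g c p (curvature g X e0 e0 c p) (X c p) =
  gdot g c p (nabla g X e0 c p) (nabla g X e0 c p).
Proof.
move=> sX dp; have sXe := smooth_nabla g sX s0.
have nab00 : nabla g X (nabla g e0 e0) c p = 0.
  rewrite (nabla_ext g X dp (Y' := fun _ _ => 0)) ?nabla0 // => q.
  exact: skew_nabla_geodesic.
rewrite /curvature nab00 sub0r gdotBl gdotNl.
have D0 : dir_deriv c (e0 c p) (inner g (nabla g X e0) X c) p = 0.
  by apply: deriv_inner_cst => // q dq; exact: skew_nabla_self.
have := nabla_metric g e0 sXe sX dp; rewrite D0 -![inner _ _ _ _ _]/(gdot g c p _ _).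
have -> : gdot g c p (nabla g (lie_bracket X e0) e0 c p) (X c p) =
    - gdot g c p (lie_bracket X e0 c p) (nabla g X e0 c p) by exact: sk.
rewrite -(nabla_torsion_free g sX s0 dp) gdotBl (gdotC _ (nabla g e0 X c p)) //.
move: (gdot _ _ _ _ _) (gdot _ _ _ _ _) (gdot _ _ _ _ _) => x y z; lra.
Qed.

End SkewUnitField.

Section SasakianFrame.
Context {R : realType} {M : smooth_manifold R 3}.
Variables (g : riemannian_metric M) (e0 : field M).
Hypotheses (s0 : smooth_field e0) (u0 : unit_field g e0) (sk : skew_nabla g e0).
Implicit Types (c d : chart M) (p q : M) (X Y Z : field M) (u v w : 'rV[R]_3).

Lemma skew_divergence_free : divergence_free g e0.
Proof.
move=> V e1 e2 oV _ c p Vp dp; rewrite rho_eq /= /shape_form !skew_nabla_self //.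
by rewrite addr0 mulr0 oppr0.
Qed.

Lemma skew_shear_free : shear_free g e0.
Proof.
move=> V e1 e2 oV _ c p Vp dp; rewrite sigma_eq /shape_form !skew_nabla_self //.
by rewrite (sk dp (e2 c p)) (gdotC _ (e2 c p)) // subrr subrr mulr0 oppr0.
Qed.

Hypothesis norm_nabla : forall c p u, dom c p ->
  gdot g c p (u *m cov_matrix g e0 c p) (u *m cov_matrix g e0 c p) =
  gdot g c p u u - gdot g c p u (e0 c p) ^+ 2.

Lemma orthogonal_vector c p : dom c p ->
  exists2 u : 'rV[R]_3, u != 0 & gdot g c p u (e0 c p) = 0.
Proof.
move=> dp; pose L : 'M[R]_(3, 1) := gram g c p *m (e0 c p)^T.
have : kermx L != 0.
  rewrite -mxrank_eq0 mxrank_ker -lt0n subn_gt0.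
  by rewrite (leq_ltn_trans (rank_leq_col L)).
move=> /rowV0Pn[u /sub_kermxP uL un0]; exists u => //.
by rewrite /gdot -mulmxA uL mxE.
Qed.

(** * A local orthonormal frame from a global field orthogonal to e0 *)

Section NormalizedFrame.
Variable Y : field M.
Hypotheses (sY : smooth_field Y)
  (Yperp : forall c p, dom c p -> gdot g c p (Y c p) (e0 c p) = 0).

Definition nonvanishing_set : set M := [set q | exists2 c, dom c q & 0 < inner g Y Y c q].

Lemma nonvanishing_gt0 c q : nonvanishing_set q -> dom c q -> 0 < inner g Y Y c q.
Proof. by move=> [d dq +] cq; rewrite (inner_change g sY sY cq dq). Qed.

Lemma open_nonvanishing : open nonvanishing_set.
Proof.
rewrite openE => q [c dq Yq].
have df := inner_differentiable g sY sY dq.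
set f := inner g Y Y c \o chart_inv c in df.
have fq : 0 < f (chart_map c q) by rewrite /f /= chart_mapK.
have nf : \forall y \near chart_map c q, 0 < f y.
  have cf : f y @[y --> chart_map c q] --> f (chart_map c q).
    exact: differentiable_continuous.
  by apply: (cf [set t | 0 < t]); apply: open_nbhs_nbhs; split=> //; exact: open_gt.
have nq : \forall q' \near q, 0 < f (chart_map c q') := chart_map_continuous dq nf.
have nd : \forall q' \near q, dom c q' by exact: near_dom.
apply: filterS2 nq nd => q' fq' dq'.
by exists c => //; move: fq'; rewrite /f /= chart_mapK.
Qed.

Definition normalizer c q : R := (Num.sqrt (inner g Y Y c q))^-1.

Definition normalized : field M := fun c q => normalizer c q *: Y c q.

Lemma scaled_smooth Z : smooth_field Z ->
  smooth_field_on nonvanishing_set (fun c q => normalizer c q *: Z c q).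
Proof.
move=> [lZ cZ]; split=> [c d q Vq cq dq|c k].
  by rewrite (lZ c d q I cq dq) /normalizer (inner_change g sY sY cq dq) scalemxAl.
have oI : open (chart_image c nonvanishing_set) := open_chart_image open_nonvanishing.
apply: of_class_C_mxZ => //; last exact: (@smooth_in_chartsW _ _ _ _ nonvanishing_set _ cZ).
have pos y : chart_image c nonvanishing_set y -> 0 < (inner g Y Y c \o chart_inv c) y.
  by move=> [q [dq Vq] <-]; rewrite /= chart_mapK //; exact: nonvanishing_gt0.
have [_ cY] := sY; have cYY := smooth_in_charts_inner g openT cY cY.
apply: of_class_CV => //.
  by move=> y /pos fy; rewrite gt_eqF ?sqrtr_gt0.
apply: of_class_C_sqrt => //.
exact: (@smooth_in_chartsW _ _ _ _ nonvanishing_set _ cYY).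
Qed.

(** [nabla] is linear over functions in its direction, so no derivative of the normalizing factor
    appears. *)
Lemma nabla_normalizedE c q :
  nabla g normalized e0 c q = normalizer c q *: nabla g Y e0 c q.
Proof. by rewrite /nabla /normalized scalemxAl. Qed.

Lemma normalized_frame :
  orthonormal_completion g nonvanishing_set e0 normalized (nabla g normalized e0).
Proof.
split; first exact: scaled_smooth.
  have [l sm] := scaled_smooth (smooth_nabla g sY s0).
  split=> [c d q Vq cq dq|c]; first by rewrite !nabla_normalizedE; exact: l.
  have -> : nabla g normalized e0 c = fun q => normalizer c q *: nabla g Y e0 c q.
    by apply/funext => q; exact: nabla_normalizedE.
  exact: sm.
move=> c q Vq dq; have Y0 := nonvanishing_gt0 Vq dq.
have n1 : gdot g c q (normalized c q) (normalized c q) = 1.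
  rewrite /normalized gdotZl gdotZr // mulrA -expr2 exprVn sqr_sqrtr ?ltW //.
  by rewrite mulVf // gt_eqF.
have n0 : gdot g c q (normalized c q) (e0 c q) = 0.
  by rewrite /normalized gdotZl Yperp // mulr0.
rewrite -![inner _ _ _ _ _]/(gdot g c q _ _); split; split; rewrite ?n1 //.
- exact: u0.
- by rewrite norm_nabla // n1 n0 expr0n subr0.
- by rewrite gdotC.
- by rewrite gdotC //; exact: nabla_unit.
- by rewrite gdotC //; exact: skew_nabla_self.
Qed.

End NormalizedFrame.

Lemma skew_twist_one : twist_one g e0.
Proof.
move=> p; have [c dp] := charts_cover p.
have [u un0 ue0] := orthogonal_vector dp.
have [X sX Xp] := smooth_field_through dp u.
(* X itself is orthogonal to e0 only at p, phi X everywhere; and phi X does not vanish at p, because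
   phi preserves the length of vectors orthogonal to e0. *)
have sY := smooth_nabla g sX s0; set Y := nabla g X e0 in sY.
have Yperp d q : dom d q -> gdot g d q (Y d q) (e0 d q) = 0.
  by move=> dq; exact: nabla_unit.
exists (nonvanishing_set Y), (normalized Y), (nabla g (normalized Y) e0).
have frame := normalized_frame sY Yperp.
split=> //; first exact: open_nonvanishing.
  exists c => //; rewrite -[inner _ _ _ _ _]/(gdot g c p _ _) /Y /nabla Xp norm_nabla //.
  by rewrite ue0 expr0n subr0; exact: gdot_gt0.
move=> d q Vq dq; have [_ _ /(_ d q Vq dq)[[_ _ n2] _]] := frame.
rewrite rho_eq /= /shape_form (sk dq (nabla _ _ _ _ _)).
rewrite -[gdot _ _ _ _ _]/(inner g (nabla g (normalized Y) e0)
  (nabla g (normalized Y) e0) d q).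
by rewrite n2 opprK; lra.
Qed.

End SasakianFrame.

(** * From congruences to Sasakian manifolds *)

Section ContactFrame.
Context {R : realType} {M : smooth_manifold R 3}.
Variables (g : riemannian_metric M) (e0 : field M).
Hypotheses (geo : geodesic_congruence g e0) (div : divergence_free g e0)
  (shear : shear_free g e0) (twist : twist_one g e0).
Implicit Types (c d : chart M) (p q : M) (X Y Z : field M) (u v w : 'rV[R]_3).

Local Notation phi c p u := (u *m cov_matrix g e0 c p).

(** Four real linear equations (sigma = 0, rho = i) fix the four entries of the form g(phi u, v) on
    the plane; phi has no component along e0 because e0 is a unit field. *)
Lemma contact_frame c p : dom c p -> exists e1 e2 : 'rV[R]_3,
  [/\ [/\ gdot g c p (e0 c p) (e0 c p) = 1, gdot g c p e1 e1 = 1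
        & gdot g c p e2 e2 = 1],
      [/\ gdot g c p (e0 c p) e1 = 0, gdot g c p (e0 c p) e2 = 0
        & gdot g c p e1 e2 = 0] &
      [/\ phi c p (e0 c p) = 0, phi c p e1 = e2 & phi c p e2 = - e1]].
Proof.
move=> dp; have [s0 u0 geo0] := geo.
have [V [e1 [e2 [oV Vp frame tw]]]] := twist p.
have [_ _ /(_ c p Vp dp)[n_ z_]] := frame.
have := tw c p Vp dp; have := div oV frame Vp dp; have := shear oV frame Vp dp.
rewrite sigma_eq rho_eq /= => -[sig1 sig2] re im.
exists (e1 c p), (e2 c p); split=> //.
have exp v := orthonormal_expansion v dp n_ z_.
split; first exact: (geo0 c p dp).
  rewrite [LHS]exp (nabla_unit _ s0 u0 dp) -!/(shape_form _ _ _ _ _ _).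
  rewrite (_ : shape_form _ _ _ _ _ _ = 0); last by lra.
  rewrite (_ : shape_form _ _ _ _ _ _ = 1); last by lra.
  by rewrite !scale0r !add0r scale1r.
rewrite [LHS]exp (nabla_unit _ s0 u0 dp) -!/(shape_form _ _ _ _ _ _).
rewrite (_ : shape_form _ _ _ _ _ _ = -1); last by lra.
rewrite (_ : shape_form _ _ _ _ _ _ = 0); last by lra.
by rewrite !scale0r add0r addr0 scaleN1r.
Qed.

Lemma contact_square c p u : dom c p ->
  phi c p (phi c p u) = - u + gdot g c p u (e0 c p) *: e0 c p.
Proof.
move=> dp; have [e1 [e2 [n_ z_ [p0 p1 p2]]]] := contact_frame dp.
have := orthonormal_expansion u dp n_ z_.
move: (gdot g c p u (e0 c p)) (gdot g c p u e1) (gdot g c p u e2) => a b d ->.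
rewrite !mulmxDl -!scalemxAl p0 p1 p2 mul0mx scaler0 add0r mulNmx p1.
by apply/rowP => i; rewrite !mxE; ring.
Qed.

Lemma contact_skew : skew_nabla g e0.
Proof.
move=> c p dp u v; have [e1 [e2 [n_ z_ [p0 p1 p2]]]] := contact_frame dp.
have := orthonormal_expansion u dp n_ z_; have := orthonormal_expansion v dp n_ z_.
move: (gdot g c p u (e0 c p)) (gdot g c p u e1) (gdot g c p u e2) => a b d vE ->.
move: vE; move: (gdot g c p v (e0 c p)) (gdot g c p v e1) (gdot g c p v e2) => a' b' d' ->.
have [n0 n1 n2] := n_; have [z01 z02 z12] := z_.
rewrite !mulmxDl -!scalemxAl p0 p1 p2 !scaler0 !add0r.
rewrite !(gdotDl, gdotZl, gdotNl) !(gdotDr, gdotZr, gdotNr) //.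
rewrite !(gdotC _ e1 (e0 c p)) ?(gdotC _ e2 (e0 c p)) ?(gdotC _ e2 e1) //.
rewrite n1 n2 z01 z02 z12.
ring.
Qed.

(** The covariant derivative of phi along X, applied to Y. *)
Definition nabla2 X Y c p := nabla g X (nabla g Y e0) c p - nabla g (nabla g X Y) e0 c p.

(** The covariant derivative of a skew operator is skew: differentiate g(phi Y, Z) = -g(Y, phi Z)
    along X. *)
Lemma nabla2_skew X Y Z c p : smooth_field X -> smooth_field Y -> smooth_field Z ->
  dom c p -> gdot g c p (nabla2 X Y c p) (Z c p) = - gdot g c p (Y c p) (nabla2 X Z c p).
Proof.
move=> sX sY sZ dp; have [s0 u0 geo0] := geo; have sk := contact_skew.
have sY0 := smooth_nabla g sY s0; have sZ0 := smooth_nabla g sZ s0.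
have dYZ := inner_differentiable g sY sZ0 dp.
have E : dir_deriv c (X c p) (inner g (nabla g Y e0) Z c) p =
    - dir_deriv c (X c p) (inner g Y (nabla g Z e0) c) p.
  have dN : dir_deriv c (X c p) (fun q => - inner g Y (nabla g Z e0) c q) p =
      - dir_deriv c (X c p) (inner g Y (nabla g Z e0) c) p.
    exact: deriveN (diff_derivable dYZ).
  by rewrite -dN; apply: dir_deriv_near => // q dq; exact: sk.
move: E; rewrite (nabla_metric g X sY0 sZ dp) (nabla_metric g X sY sZ0 dp).
rewrite -![inner _ _ _ _ _]/(gdot g c p _ _) /nabla2 gdotBl gdotBr //.
have -> : gdot g c p (nabla g (nabla g X Y) e0 c p) (Z c p) =
  - gdot g c p (nabla g X Y c p) (nabla g Z e0 c p) by exact: sk.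
have -> : gdot g c p (nabla g Y e0 c p) (nabla g X Z c p) =
  - gdot g c p (Y c p) (nabla g (nabla g X Z) e0 c p) by exact: sk.
by move=> E; lra.
Qed.

(** Since phi e0 = 0, only -phi (phi X) remains. *)
Lemma nabla2_e0 X c p : dom c p ->
  nabla2 X e0 c p = X c p - gdot g c p (X c p) (e0 c p) *: e0 c p.
Proof.
move=> dp; have [s0 u0 geo0] := geo; rewrite /nabla2.
have -> : nabla g X (nabla g e0 e0) c p = 0.
  by rewrite (nabla_ext g X dp (Y' := fun _ _ => 0)) ?nabla0 // => q; exact: geo0.
have -> : nabla g (nabla g X e0) e0 c p = phi c p (phi c p (X c p)) by [].
by rewrite contact_square // sub0r opprD opprK.
Qed.

Lemma contact_norm c p u : dom c p ->
  gdot g c p (phi c p u) (phi c p u) =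
  gdot g c p u u - gdot g c p u (e0 c p) * gdot g c p u (e0 c p).
Proof.
move=> dp; rewrite contact_skew // contact_square // gdotDr // gdotNr // gdotZr //.
by rewrite opprD opprK.
Qed.

(** Half the derivative along X of g(phi Y, phi Y) = g(Y, Y) - g(Y, e0)^2; the terms that
    differentiate Y match by the polarized form of the same identity. *)
Lemma nabla2_self X Y c p : smooth_field X -> smooth_field Y -> dom c p ->
  gdot g c p (nabla2 X Y c p) (nabla g Y e0 c p) =
  gdot g c p (e0 c p) (Y c p) * gdot g c p (X c p) (nabla g Y e0 c p).
Proof.
move=> sX sY dp; have [s0 u0 geo0] := geo; have sk := contact_skew.
have sY0 := smooth_nabla g sY s0.
have d1 := inner_differentiable g sY sY dp.
have d2 := inner_differentiable g sY s0 dp.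
have E : dir_deriv c (X c p) (inner g (nabla g Y e0) (nabla g Y e0) c) p =
    dir_deriv c (X c p) (inner g Y Y c) p
    - 2 * (inner g Y e0 c p * dir_deriv c (X c p) (inner g Y e0 c) p).
  have dN : dir_deriv c (X c p) (fun q => inner g Y Y c q
        - inner g Y e0 c q * inner g Y e0 c q) p =
      dir_deriv c (X c p) (inner g Y Y c) p
      - 2 * (inner g Y e0 c p * dir_deriv c (X c p) (inner g Y e0 c) p).
    have d1' := diff_derivable (v := X c p) d1; have d2' := diff_derivable (v := X c p) d2.
    apply: etrans (deriveB d1' (derivableM d2' d2')) _.
    by rewrite deriveM // /= chart_mapK // -[_ *: _]/(_ * _) mulr_natl mulr2n.
  by rewrite -dN; apply: dir_deriv_near => // q dq; exact: contact_norm.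
move: E; rewrite (nabla_metric g X sY0 sY0 dp) (nabla_metric g X sY sY dp).
rewrite (nabla_metric g X sY s0 dp).
rewrite -![inner _ _ _ _ _]/(gdot g c p _ _) /nabla2 gdotBl.
have -> : gdot g c p (nabla g (nabla g X Y) e0 c p) (nabla g Y e0 c p) =
    gdot g c p (nabla g X Y c p) (Y c p)
    - gdot g c p (Y c p) (e0 c p) * gdot g c p (nabla g X Y c p) (e0 c p).
  apply: etrans (sk c p dp _ _) _; rewrite contact_square // gdotDr // gdotNr // gdotZr //.
  by rewrite opprD opprK.
have -> : gdot g c p (Y c p) (nabla g X e0 c p) = - gdot g c p (X c p) (nabla g Y e0 c p).
  by rewrite gdotC //; exact: sk.
rewrite (gdotC _ (nabla g Y e0 c p) (nabla g X (nabla g Y e0) c p)) //.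
rewrite (gdotC _ (Y c p) (nabla g X Y c p)) // (gdotC _ (e0 c p) (Y c p)) //.
move: (gdot _ _ _ _ _) (gdot _ _ _ _ _) (gdot _ _ _ _ _) (gdot _ _ _ _ _)
  (gdot _ _ _ _ _) => a b d e f E.
nra.
Qed.

Lemma nabla2E X Y c p : smooth_field X -> smooth_field Y -> dom c p ->
  nabla2 X Y c p =
  gdot g c p (e0 c p) (Y c p) *: X c p - gdot g c p (X c p) (Y c p) *: e0 c p.
Proof.
move=> sX sY dp; have [s0 u0 geo0] := geo; have sk := contact_skew.
have [e1 [e2 [n_ z_ [p0 p1 p2]]]] := contact_frame dp.
have [n0 n1 n2] := n_; have [z01 z02 z12] := z_.
pose D Z : 'rV[R]_3 := nabla2 X Z c p -
  (gdot g c p (e0 c p) (Z c p) *: X c p - gdot g c p (X c p) (Z c p) *: e0 c p).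
have DE Z w : gdot g c p (D Z) w = gdot g c p (nabla2 X Z c p) w -
    (gdot g c p (e0 c p) (Z c p) * gdot g c p (X c p) w
     - gdot g c p (X c p) (Z c p) * gdot g c p (e0 c p) w).
  by apply: etrans (gdotBl _ _ _ _ _ _) _; congr (_ - _); rewrite gdotBl !gdotZl.
have zero w : gdot g c p w (e0 c p) = 0 -> gdot g c p w e1 = 0 ->
    gdot g c p w e2 = 0 -> w = 0.
  move=> w0 w1 w2; rewrite (orthonormal_expansion w dp n_ z_) w0 w1 w2.
  by rewrite !scale0r !addr0.
have Dskew Z W : smooth_field Z -> smooth_field W ->
    gdot g c p (D Z) (W c p) = - gdot g c p (D W) (Z c p).
  move=> sZ sW; rewrite !DE (nabla2_skew sX sZ sW dp).
  rewrite (gdotC _ (Z c p) (nabla2 X W c p)) //; ring.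
have De0 : D e0 = 0.
  by rewrite /D nabla2_e0 // n0 scale1r subrr.
have D0 Z : smooth_field Z -> gdot g c p (D Z) (e0 c p) = 0.
  by move=> sZ; rewrite (Dskew _ _ sZ s0) De0 gdot0l oppr0.
have Dself Z : smooth_field Z -> gdot g c p (D Z) (Z c p) = 0.
  by move=> sZ; have := Dskew _ _ sZ sZ; move: (gdot _ _ _ _ _) => a E; lra.
have Dphi Z : smooth_field Z -> gdot g c p (D Z) (nabla g Z e0 c p) = 0.
  move=> sZ; rewrite DE (nabla2_self sX sZ dp).
  have -> : gdot g c p (e0 c p) (nabla g Z e0 c p) = 0.
    by rewrite gdotC //; exact: nabla_unit.
  ring.
have [E1 sE1 E1p] := smooth_field_through dp e1.
have sE2 := smooth_nabla g sE1 s0; set E2 := nabla g E1 e0 in sE2.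
have E2p : E2 c p = e2 by rewrite /E2 /nabla E1p.
(* [D E1] is orthogonal to e0, to e1 and to e2 = phi e1, hence zero. Skewness then carries this over
   to [D E2] and to [D Y]. *)
have D1 : D E1 = 0.
  by apply: zero; [exact: D0|rewrite -E1p; exact: Dself|rewrite -E2p; exact: Dphi].
have D2 : D E2 = 0.
  apply: zero; [exact: D0| |rewrite -E2p; exact: Dself].
  by rewrite -E1p (Dskew _ _ sE2 sE1) D1 gdot0l oppr0.
apply/eqP; rewrite -subr_eq0; apply/eqP; apply: zero; first exact: D0.
  by rewrite -E1p (Dskew _ _ sY sE1) D1 gdot0l oppr0.
by rewrite -E2p (Dskew _ _ sY sE2) D2 gdot0l oppr0.
Qed.

(** By vanishing torsion, the curvature on e0 is the antisymmetrized second covariant derivative of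
    e0; the multiples of e0 in [nabla2E] are symmetric and cancel. *)
Lemma curvature_contact X Y c p : smooth_field X -> smooth_field Y -> dom c p ->
  curvature g X Y e0 c p =
  gdot g c p (e0 c p) (Y c p) *: X c p - gdot g c p (e0 c p) (X c p) *: Y c p.
Proof.
move=> sX sY dp; have -> : curvature g X Y e0 c p = nabla2 X Y c p - nabla2 Y X c p.
  rewrite /curvature /nabla2 [nabla g (lie_bracket X Y) _ _ _]/nabla.
  rewrite -(nabla_torsion_free g sX sY dp) mulmxBl.
  rewrite -![_ *m cov_matrix _ _ _ _]/(nabla g (nabla g _ _) e0 c p).
  by apply/rowP => k; rewrite !mxE; ring.
rewrite (nabla2E sX sY dp) (nabla2E sY sX dp) (gdotC _ (Y c p) (X c p)) //.
by apply/rowP => k; rewrite !mxE; ring.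
Qed.

Lemma curvature_reeb X Y c p : smooth_field X -> smooth_field Y -> dom c p ->
  curvature g X e0 Y c p =
  gdot g c p (e0 c p) (Y c p) *: X c p - gdot g c p (X c p) (Y c p) *: e0 c p.
Proof.
move=> sX sY dp; have [s0 u0 geo0] := geo.
pose D A B : 'rV[R]_3 := curvature g A e0 B c p -
  (gdot g c p (e0 c p) (B c p) *: A c p - gdot g c p (A c p) (B c p) *: e0 c p).
have DE A B w : gdot g c p (D A B) w = gdot g c p (curvature g A e0 B c p) w -
    (gdot g c p (e0 c p) (B c p) * gdot g c p (A c p) w
     - gdot g c p (A c p) (B c p) * gdot g c p (e0 c p) w).
  by apply: etrans (gdotBl _ _ _ _ _ _) _; congr (_ - _); rewrite gdotBl !gdotZl.
have Dskew A B C : smooth_field A -> smooth_field B -> smooth_field C ->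
    gdot g c p (D A B) (C c p) = - gdot g c p (D A C) (B c p).
  move=> sA sB sC; rewrite !DE (curvature_skew g sA s0 sB sC dp).
  rewrite (gdotC _ (B c p)) //; ring.
(* The Bianchi identity leaves the curvature of A and B on e0, which [curvature_contact] shows to
   equal the antisymmetrization of the claimed value. *)
have Dsym A B : smooth_field A -> smooth_field B -> D A B = D B A.
  move=> sA sB; have := bianchi g sA s0 sB dp.
  rewrite (curvatureC g B e0 A) (curvature_contact sB sA dp) /D.
  rewrite (gdotC _ (B c p) (A c p)) // => E; apply/rowP => k.
  by move/rowP/(_ k): E; rewrite !mxE => E; lra.
(* A trilinear form symmetric in its first two arguments and skew in its last two is zero: three
   skew swaps, alternated with symmetric ones, return to the start with the sign reversed. *)
have D0 Z : smooth_field Z -> gdot g c p (D X Y) (Z c p) = 0.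
  move=> sZ; have e1 := Dskew _ _ _ sX sY sZ; have e2 := Dskew _ _ _ sZ sX sY.
  have e3 := Dskew _ _ _ sY sZ sX.
  rewrite (Dsym _ _ sZ sX) in e2; rewrite (Dsym _ _ sY sX) (Dsym _ _ sZ sY) in e3 e2.
  move: e1 e2 e3; move: (gdot _ _ _ _ _) (gdot _ _ _ _ _) (gdot _ _ _ _ _) => a b d *.
  lra.
apply/eqP; rewrite -subr_eq0; apply/eqP; apply: (gdot_inj (g := g) dp) => w.
have [Z sZ <-] := smooth_field_through dp w.
by rewrite gdot0l; exact: D0.
Qed.

End ContactFrame.

Theorem theorem2 (R : realType) (M : smooth_manifold R 3)
    (g : riemannian_metric M) :
  sasakian g <->
  exists e0 : field M,
    [/\ geodesic_congruence g e0, divergence_free g e0, shear_free g e0 &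
        twist_one g e0].
Proof.
split=> [[e0 [s0 u0 kf curv]]|[e0 [geo div shear twist]]]; exists e0.
  have sk := (killing_skewP g s0).1 kf; split.
  - by split=> // c p dp; exact: skew_nabla_geodesic.
  - exact: skew_divergence_free.
  - exact: skew_shear_free.
  apply: skew_twist_one => // c p u dp.
  (* The length of phi u comes from comparing the two values of g(R(X, e0)e0, X): the Sasakian
     condition with Y = e0, and [curvature_skew_nabla]. *)
  have [X sX Xp] := smooth_field_through dp u.
  have := curvature_skew_nabla s0 u0 sk sX dp.
  rewrite (curv X e0 sX s0 c p dp) u0 // gdotBl !gdotZl mul1r.
  rewrite -[inner _ _ _ _ _]/(gdot g c p _ _).
  by rewrite (gdotC _ (e0 c p)) // /nabla Xp expr2 => <-.
have [s0 u0 _] := geo; split=> //.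
  by apply/killing_skewP => //; exact: contact_skew.
by move=> X Y sX sY c p dp; exact: curvature_reeb.
Qed.
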